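(* One has $$H^1_{dR}(U,\nabla)=\frac{\Gamma(X,\Omega_X(5\cdot\infty))}{\nabla\,\Gamma(X,\mathcal{O}_X(\infty))}.$$ Therefore $H^1_{dR}(U,\nabla)$ is generated by (the classes of) $\frac{dx}{y},\ x\frac{dx}{y},\ dx,\ x\,dx$.
   Context: Let $k\subset\mathbb{C}$ be a field, $\lambda\in k\setminus\{0,1\}$, and let $U$ be the affine Legendre elliptic curve $y^2=x(x-1)(x-\lambda)$ over $k$. Let $X$ be its completion in $\mathbb{P}^2$, so that $U=X\setminus\{\infty\}$ for a single point $\infty$. Let $\nabla=d+dy$ be the connection on $\mathcal{O}_U$ given by $\nabla(g)=dg+g\,dy$. It has an irregular singularity at $\infty$. The de Rham cohomology $H^*_{dR}(U,\nabla)$ is the hypercohomology of the de Rham complex $\mathcal{O}_U\xrightarrow{\nabla}\Omega_U$; since $U$ is affine, $H^1_{dR}(U,\nabla)=\Gamma(X,\Omega_X( *\infty))/\nabla\Gamma(X,\mathcal{O}_X( *\infty))$, where $( *\infty)$ means arbitrary poles at $\infty$ are allowed. The equality in the claim is the identification induced by the natural inclusion of $\Gamma(X,\Omega_X(5\cdot\infty))$ in $\Gamma(X,\Omega_X( *\infty))$. *)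

(* Defs.v *)
From HB Require Import structures.
From mathcomp Require Import all_boot all_order all_algebra all_field.
From mathcomp Require Import qfpoly generic_quotient ring_quotient fraction.
From mathcomp Require Import boolp reals complex freeg ring.

Set Implicit Arguments.
Unset Strict Implicit.
Unset Printing Implicit Defensive.

Import GRing.Theory.
Local Open Scope ring_scope.
Local Open Scope quotient_scope.

(* The B-linear span of S, for a set of scalars B. *)
Inductive spanned (R : nzRingType) (V : lmodType R) (B : R -> Prop)
    (S : V -> Prop) : V -> Prop :=
| Spanned0 : spanned B S 0
| SpannedS a u v : B a -> S u -> spanned B S v -> spanned B S (a *: u + v).

Lemma spannedD (R : nzRingType) (V : lmodType R) (B : R -> Prop)
    (S : V -> Prop) u v :
  spanned B S u -> spanned B S v -> spanned B S (u + v).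
Proof.
move=> su sv; elim: su => [|a u1 u2 Ba Su _ IH]; first by rewrite add0r.
by rewrite -addrA; apply: SpannedS.
Qed.

Lemma spannedZ (R : nzRingType) (V : lmodType R) (B : R -> Prop)
    (S : V -> Prop) c u :
  (forall a, B a -> B (c * a)) -> spanned B S u -> spanned B S (c *: u).
Proof.
move=> Bc; elim=> [|a u1 u2 Ba Su _ IH]; first by rewrite scaler0; left.
by rewrite scalerDr scalerA; apply: SpannedS => //; apply: Bc.
Qed.

Section QuotientModule.
Variables (R : nzRingType) (V : lmodType R) (N : submodClosed V).

(* N as a subgroup: submodClosed does not record stability under opposite. *)
Definition subgroup_of_submod : {pred V} := N.

Lemma subgroup_of_submod_closed : zmod_closed subgroup_of_submod.
Proof.
split=> [|u v]; rewrite /subgroup_of_submod; first exact: rpred0.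
by move=> Nu Nv; rewrite -scaleN1r rpredD // rpredZ.
Qed.

HB.instance Definition _ :=
  GRing.isZmodClosed.Build V subgroup_of_submod subgroup_of_submod_closed.

Local Notation Q := (Quotient.quot subgroup_of_submod).
Definition quotmod : Type := Q.
HB.instance Definition _ := GRing.Zmodule.on quotmod.

Definition quotmod_pi (v : V) : quotmod := \pi_Q v.

Lemma quotmod_piP u v : reflect (quotmod_pi u = quotmod_pi v) (u - v \in N).
Proof.
by rewrite -[_ \in N]/(_ \in subgroup_of_submod) Quotient.idealrBE; apply: eqP.
Qed.

Lemma quotmod_pi_surj (q : quotmod) : exists v, q = quotmod_pi v.
Proof. by exists (repr (q : Q)); rewrite /quotmod_pi reprK. Qed.

Definition quotmod_scale (a : R) (q : quotmod) : quotmod :=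
  quotmod_pi (a *: repr (q : Q)).

Lemma quotmod_piD u v : quotmod_pi (u + v) = quotmod_pi u + quotmod_pi v.
Proof. exact: (raddfD (\pi_Q)). Qed.

Lemma quotmod_piZ a v : quotmod_pi (a *: v) = quotmod_scale a (quotmod_pi v).
Proof.
apply/quotmod_piP; rewrite -scalerBr rpredZ //.
by apply/quotmod_piP; rewrite /quotmod_pi reprK.
Qed.

Lemma quotmod_scaleA a b q :
  quotmod_scale a (quotmod_scale b q) = quotmod_scale (a * b) q.
Proof.
by have [v ->] := quotmod_pi_surj q; rewrite -!quotmod_piZ scalerA.
Qed.

Lemma quotmod_scale1 : left_id 1 quotmod_scale.
Proof.
by move=> q; have [v ->] := quotmod_pi_surj q; rewrite -!quotmod_piZ scale1r.
Qed.

Lemma quotmod_scaleDr : right_distributive quotmod_scale +%R.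
Proof.
move=> a p q; have [[u ->] [v ->]] := (quotmod_pi_surj p, quotmod_pi_surj q).
by rewrite -quotmod_piD -!quotmod_piZ -quotmod_piD scalerDr.
Qed.

Lemma quotmod_scaleDl q : {morph quotmod_scale^~ q : a b / a + b}.
Proof.
move=> a b; have [v ->] := quotmod_pi_surj q.
by rewrite -!quotmod_piZ -quotmod_piD scalerDl.
Qed.

HB.instance Definition _ := GRing.Zmodule_isLmodule.Build R quotmod
  quotmod_scaleA quotmod_scale1 quotmod_scaleDr quotmod_scaleDl.

Lemma quotmod_pi_is_linear : linear quotmod_pi.
Proof. by move=> a u v; rewrite quotmod_piD quotmod_piZ. Qed.

HB.instance Definition _ :=
  GRing.isLinear.Build R V quotmod _ quotmod_pi quotmod_pi_is_linear.

End QuotientModule.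

(* For submodules S and T of V, the module S / (S \cap T); it is S / T as
   soon as T is contained in S. *)
Section SubQuotient.
Variables (R : nzRingType) (V : lmodType R) (S T : submodClosed V).

Definition submod : Type := {v : V | v \in S}.
HB.instance Definition _ := SubType.on submod.
HB.instance Definition _ := [Choice of submod by <:].
HB.instance Definition _ := [SubChoice_isSubLmodule of submod by <:].

Definition submod_inter : {pred submod} := [pred w | val w \in T].

Lemma submod_inter_closed : submod_closed submod_inter.
Proof.
split=> [|a u v]; first by rewrite inE raddf0 rpred0.
by rewrite !inE => Tu Tv; rewrite raddfD /= rpredD // rpredZ.
Qed.

HB.instance Definition _ :=
  GRing.isSubmodClosed.Build R submod submod_inter submod_inter_closed.

Definition subquot : Type := quotmod submod_inter.
HB.instance Definition _ := GRing.Lmodule.on subquot.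

(* The class of v; meaningful only for v \in S (otherwise it is 0). *)
Definition class_of (v : V) : subquot := quotmod_pi submod_inter (insubd 0 v).

End SubQuotient.

Definition restr (k K : nzRingType) (iota : {rmorphism k -> K})
  (V : lmodType K) : Type := V.

Section Restriction.
Variables (k K : nzRingType) (iota : {rmorphism k -> K}) (V : lmodType K).
Local Notation W := (restr iota V).

HB.instance Definition _ := GRing.Zmodule.on W.

Definition restr_scale (a : k) (v : W) : W := iota a *: (v : V).

Lemma restr_scaleA a b v :
  restr_scale a (restr_scale b v) = restr_scale (a * b) v.
Proof. by rewrite /restr_scale scalerA rmorphM. Qed.
Lemma restr_scale1 : left_id 1 restr_scale.
Proof. by move=> v; rewrite /restr_scale rmorph1 scale1r. Qed.
Lemma restr_scaleDr : right_distributive restr_scale +%R.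
Proof. by move=> a u v; apply: scalerDr. Qed.
Lemma restr_scaleDl v : {morph restr_scale^~ v : a b / a + b}.
Proof. by move=> a b; rewrite /restr_scale rmorphD scalerDl. Qed.

HB.instance Definition _ := GRing.Zmodule_isLmodule.Build k W
  restr_scaleA restr_scale1 restr_scaleDr restr_scaleDl.

End Restriction.

Section Kaehler.
Variables (k K : comNzRingType) (iota : {rmorphism k -> K}).

Definition is_derivation (M : lmodType K) (D : K -> M) :=
  [/\ forall a b, D (a + b) = D a + D b,
      forall a b, D (a * b) = a *: D b + b *: D a
    & forall c, D (iota c) = 0].

Inductive kaehler_rel : {freeg K / K} -> Prop :=
| KaehlerD a b : kaehler_rel (<< a + b >> - << a >> - << b >>)
| KaehlerM a b : kaehler_rel (<< a * b >> - << a *g b >> - << b *g a >>)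
| KaehlerC c : kaehler_rel << iota c >>.

Definition kaehler_relspan : {pred {freeg K / K}} :=
  [pred u | `[< spanned (fun _ => True) kaehler_rel u >]].

Lemma kaehler_relspan_closed : submod_closed kaehler_relspan.
Proof.
split=> [|a u v]; first by apply/asboolP; left.
move=> /asboolP su /asboolP sv; apply/asboolP; apply: spannedD => //.
exact: spannedZ.
Qed.

HB.instance Definition _ := GRing.isSubmodClosed.Build K {freeg K / K}
  kaehler_relspan kaehler_relspan_closed.

Definition kaehler : Type := quotmod kaehler_relspan.
HB.instance Definition _ := GRing.Lmodule.on kaehler.

Definition kd (g : K) : kaehler := quotmod_pi kaehler_relspan << g >>.

Lemma freegZU (c a b : K) :
  c *: (<< a *g b >> : {freeg K / K}) = << c * a *g b >>.
Proof. by apply/eqP/freeg_eqP => z; rewrite coeffZ !coeffU mulrA. Qed.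

Lemma kaehler_piU (a b : K) :
  quotmod_pi kaehler_relspan << a *g b >> = a *: kd b.
Proof. by rewrite -[a in LHS]mulr1 -freegZU linearZ. Qed.

Lemma kaehler_rel_in u : kaehler_rel u -> u \in kaehler_relspan.
Proof.
move=> ru; apply/asboolP; rewrite -[u]addr0 -[u]scale1r.
by apply: SpannedS => //; left.
Qed.

Lemma kd_derivation : is_derivation kd.
Proof.
split=> [a b|a b|c].
- rewrite -linearD; apply/quotmod_piP; rewrite opprD addrA.
  exact/kaehler_rel_in/KaehlerD.
- rewrite -!kaehler_piU -linearD; apply/quotmod_piP; rewrite opprD addrA.
  exact/kaehler_rel_in/KaehlerM.
rewrite -(linear0 (quotmod_pi kaehler_relspan)); apply/quotmod_piP.
by rewrite subr0; apply/kaehler_rel_in/KaehlerC.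
Qed.

Lemma fglift_linear (M : lmodType K) (D : K -> M) :
  linear (fglift D : {freeg K / K} -> M).
Proof.
have liftA (u v : {freeg K / K}) : fglift D (u - v) = fglift D u - fglift D v.
  exact: (lift_is_additive D).
have lift0 : fglift D 0 = 0 by rewrite -(subrr 0) liftA subrr.
have liftD (u v : {freeg K / K}) : fglift D (u + v) = fglift D u + fglift D v.
  by rewrite -{1}[v]opprK liftA -[- v]sub0r liftA lift0 sub0r opprK.
move=> c u v; rewrite liftD; congr (_ + _).
rewrite -[u]freeg_sumE; elim: (dom u) => [|z s IH].
  by rewrite big_nil scaler0 lift0 scaler0.
by rewrite big_cons scalerDr !liftD scalerDr IH freegZU !liftU scalerA.
Qed.

Lemma kaehler_universal (M : lmodType K) (D : K -> M) :
    is_derivation D ->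
  (exists phi : {linear kaehler -> M}, forall g, phi (kd g) = D g) /\
  (forall phi psi : {linear kaehler -> M},
     (forall g, phi (kd g) = psi (kd g)) -> phi =1 psi).
Proof.
move=> [DD DM DC]; pose L : {freeg K / K} -> M := fglift D.
pose Lm := GRing.isLinear.Build K {freeg K / K} M _ L (fglift_linear D).
pose Ll : {linear {freeg K / K} -> M} := HB.pack L Lm.
have L0 u : u \in kaehler_relspan -> Ll u = 0.
  move=> /asboolP; elim=> [|a r v _ rr _ IH]; first exact: linear0.
  suff Lr : Ll r = 0 by rewrite linearP IH addr0 Lr scaler0.
  case: rr => [b c|b c|c].
  - by rewrite !linearB /= /L !liftU !scale1r DD addrAC addrK subrr.
  - by rewrite !linearB /= /L !liftU !scale1r DM addrAC addrK subrr.
  by rewrite /= /L liftU DC scaler0.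
pose f (q : kaehler) := Ll (repr (q : Quotient.quot _)).
have fpi v : f (quotmod_pi kaehler_relspan v) = Ll v.
  apply/eqP; rewrite -subr_eq0 -linearB; apply/eqP/L0/quotmod_piP.
  by rewrite /quotmod_pi reprK.
have flin : linear f.
  move=> a p q; have [u ->] := quotmod_pi_surj p.
  by have [v ->] := quotmod_pi_surj q; rewrite -linearP !fpi linearP.
split.
  pose fm := GRing.isLinear.Build K kaehler M _ f flin.
  exists (HB.pack f fm : {linear kaehler -> M}) => g.
  by rewrite /= fpi /= /L liftU scale1r.
move=> phi psi eqd q; have [u ->] := quotmod_pi_surj q.
rewrite -[u]freeg_sumE !linear_sum; apply: eq_bigr => z _.
by rewrite /= kaehler_piU !linearZ eqd.
Qed.

End Kaehler.

Section FunctionField.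
Variables (k : fieldType) (lam : k).

Definition legendre_cubic : {poly k} := 'X * ('X - 1) * ('X - lam%:P).

Definition legendre_poly : {poly {fraction {poly k}}} :=
  'X^2 - (tofrac legendre_cubic)%:P.

Lemma legendre_cubicE :
  legendre_cubic = ('X - 0%:P) * ('X - 1%:P) * ('X - lam%:P).
Proof. by rewrite /legendre_cubic polyC0 subr0. Qed.

Lemma size_legendre_cubic : size legendre_cubic = 4.
Proof.
rewrite legendre_cubicE !size_Mmonic ?monicM ?monicXsubC ?size_XsubC //.
  by rewrite monic_neq0 ?monicXsubC.
by rewrite mulf_neq0 ?monic_neq0 ?monicXsubC.
Qed.

Lemma fraction_ratio (A : idomainType) (r : {fraction A}) :
  exists n d : A, d != 0 /\ r * tofrac d = tofrac n.
Proof.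
elim/quotW: r => x; exists (frac x).1, (frac x).2; split.
  exact: denom_ratioP.
apply/eqP; rewrite !piE /= /FracField.equivf /FracField.mulf.
have d1 : (1 : A) != 0 := oner_neq0 A; have dx := denom_ratioP x.
by rewrite !(numden_Ratio, mulf_neq0) // !mulr1 mulrC.
Qed.

Lemma legendre_cubic_nonsquare (r : {fraction {poly k}}) :
  r ^+ 2 != tofrac legendre_cubic.
Proof.
apply/eqP => r2; have [n [d [d0 rd]]] := fraction_ratio r.
have /eqP : tofrac (n ^+ 2) = tofrac (legendre_cubic * d ^+ 2).
  by rewrite tofracXn -rd exprMn r2 -tofracXn -tofracM.
rewrite tofrac_eq => /eqP nd.
have c0 : legendre_cubic != 0 by rewrite -size_poly_eq0 size_legendre_cubic.
have n0 : n != 0.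
  by apply: contraNneq (mulf_neq0 c0 (expf_neq0 2 d0)) => n0; rewrite -nd n0 expr0n.
have : odd (size (n ^+ 2)) = odd (size (legendre_cubic * d ^+ 2)) by rewrite nd.
rewrite [in RHS]size_mul ?expf_neq0 // size_legendre_cubic !expr2 !size_mul //.
move: n0 d0; rewrite -!size_poly_gt0.
case: (size n) => // a _; case: (size d) => // b _.
by rewrite /= !(addnS, addSn) /= !addnn !odd_double.
Qed.

Lemma legendre_poly_irreducible : monic_irreducible_poly legendre_poly.
Proof.
have sz : size legendre_poly = 3.
  rewrite /legendre_poly size_polyDl ?size_polyXn // size_polyN size_polyC.
  by case: (_ != _).
split.
  apply: cubic_irreducible; rewrite ?sz // => r.
  rewrite rootE /legendre_poly !hornerE subr_eq0.
  exact: legendre_cubic_nonsquare.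
rewrite monicE lead_coefE sz /legendre_poly coefB coefXn coefC /=.
by rewrite subr0.
Qed.

(* k(x)[Y]/(Y^2 - x(x-1)(x-lam)) *)
Definition funfield : Type :=
  {poly %/ legendre_poly with legendre_poly_irreducible}.
HB.instance Definition _ := GRing.Field.on funfield.

Definition constf (c : k) : funfield := qpolyC legendre_poly (tofrac c%:P).

Lemma constf_is_zmod_morphism : zmod_morphism constf.
Proof. by move=> a b; rewrite /constf !rmorphB. Qed.

Lemma constf_is_monoid_morphism : monoid_morphism constf.
Proof. by split=> [|a b]; rewrite /constf ?rmorph1 // !rmorphM. Qed.

HB.instance Definition _ :=
  GRing.isZmodMorphism.Build k funfield constf constf_is_zmod_morphism.
HB.instance Definition _ :=
  GRing.isMonoidMorphism.Build k funfield constf constf_is_monoid_morphism.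

Definition cx : funfield := qpolyC legendre_poly (tofrac 'X).
Definition cy : funfield := qpolyX legendre_poly.

Lemma legendre_equation : cy ^+ 2 = cx * (cx - 1) * (cx - constf lam).
Proof.
have [[_ _] mh] := legendre_poly_irreducible.
have sh : (1 < size (mk_monic legendre_poly))%N by apply: size_mk_monic_gt1.
have -> : cx * (cx - 1) * (cx - constf lam) =
          in_qpoly legendre_poly (tofrac legendre_cubic)%:P.
  rewrite /cx /constf /legendre_cubic !(tofracM, tofracB, tofrac1).
  rewrite -(rmorph1 (qpolyC legendre_poly)) -!rmorphB -!rmorphM.
  apply: val_inj => /=; rewrite Pdiv.CommonRing.rmodp_small // size_polyC.
  by case: (_ != _) => //=; rewrite ltnW.
rewrite -[LHS]/(in_qpoly legendre_poly 'X ^+ 2) -rmorphXn.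
apply/eqP; rewrite -subr_eq0 -rmorphB; apply/eqP/val_inj => /=.
by rewrite mk_monicE ?Pdiv.RingMonic.rmodpp //; apply: legendre_poly_irreducible.
Qed.

End FunctionField.

(* An integral affine plane curve U = Spec k[x, y], presented by its function
   field, a field extension of k, and the coordinate functions x and y in it.
   X denotes the closure of U in P^2. *)
Record plane_curve (k : fieldType) := PlaneCurve {
  function_field : fieldType;
  const : {rmorphism k -> function_field};
  xcoord : function_field;
  ycoord : function_field }.

Definition legendre_curve (k : fieldType) (lam : k) : plane_curve k :=
  @PlaneCurve k (funfield lam) (constf lam) (cx lam) (cy lam).

Section Connection.
Variables (k : fieldType) (C : plane_curve k).
Local Notation K := (function_field C).
Local Notation x := (xcoord C).
Local Notation y := (ycoord C).
Local Notation constf := (const C).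

Definition eval2 (p : {poly {poly k}}) (g1 g2 : K) : K :=
  (map_poly (map_poly constf) p).[g1%:P].[g2].

Definition O_U (g : K) : Prop :=
  exists p : {poly {poly k}}, g = eval2 p x y.

(* The point infinity is [0 : 1 : 0]; on the chart Y != 0 of P^2 the affine
   coordinates are u = x / y and v = 1 / y, and infinity is (u, v) = (0, 0).
   O_infty is the local ring of X there: the localization of k[u, v]. *)
Definition O_infty (g : K) : Prop :=
  exists p q : {poly {poly k}},
    [/\ q.[0].[0] != 0, eval2 q (x / y) y^-1 != 0
      & g = eval2 p (x / y) y^-1 / eval2 q (x / y) y^-1].

Definition m_infty (g : K) : Prop :=
  exists p q : {poly {poly k}},
    [/\ p.[0].[0] = 0, q.[0].[0] != 0, eval2 q (x / y) y^-1 != 0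
      & g = eval2 p (x / y) y^-1 / eval2 q (x / y) y^-1].

Definition t_infty : K := x / y.

Lemma eval2D p q g1 g2 : eval2 (p + q) g1 g2 = eval2 p g1 g2 + eval2 q g1 g2.
Proof. by rewrite /eval2 rmorphD !hornerD. Qed.

Lemma eval2M p q g1 g2 : eval2 (p * q) g1 g2 = eval2 p g1 g2 * eval2 q g1 g2.
Proof. by rewrite /eval2 rmorphM !hornerM. Qed.

Lemma eval2C c g1 g2 : eval2 c%:P%:P g1 g2 = constf c.
Proof. by rewrite /eval2 !map_polyC /= !hornerC map_polyC /= hornerC. Qed.

Lemma eval2X g1 g2 : eval2 'X g1 g2 = g1.
Proof. by rewrite /eval2 map_polyX hornerX hornerC. Qed.

Lemma eval2Y g1 g2 : eval2 'X%:P g1 g2 = g2.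
Proof. by rewrite /eval2 map_polyC /= hornerC map_polyX hornerX. Qed.

Lemma O_UC c : O_U (constf c).
Proof. by exists c%:P%:P; rewrite eval2C. Qed.

Lemma O_UD g h : O_U g -> O_U h -> O_U (g + h).
Proof. by case=> p -> [q ->]; exists (p + q); rewrite eval2D. Qed.

Lemma O_UM g h : O_U g -> O_U h -> O_U (g * h).
Proof. by case=> p -> [q ->]; exists (p * q); rewrite eval2M. Qed.

Lemma O_infty_poly p : O_infty (eval2 p (x / y) y^-1).
Proof.
exists p, 1%:P%:P; rewrite !hornerC eval2C rmorph1 divr1.
by split; rewrite ?oner_neq0.
Qed.

Lemma O_inftyC c : O_infty (constf c).
Proof. by rewrite -(eval2C c (x / y) y^-1); apply: O_infty_poly. Qed.

Lemma O_infty_t : O_infty t_infty.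
Proof.
by rewrite /t_infty -{1}(eval2X (x / y) y^-1); apply: O_infty_poly.
Qed.

Lemma O_inftyM g h : O_infty g -> O_infty h -> O_infty (g * h).
Proof.
case=> [p [q [q0 qn ->]]] [p' [q' [q0' qn' ->]]].
exists (p * p'), (q * q'); rewrite !hornerM !eval2M !mulf_neq0 //.
by split=> //; rewrite mulf_div.
Qed.

Lemma O_inftyD g h : O_infty g -> O_infty h -> O_infty (g + h).
Proof.
case=> [p [q [q0 qn ->]]] [p' [q' [q0' qn' ->]]].
exists (p * q' + p' * q), (q * q').
rewrite !hornerM !eval2D !eval2M !mulf_neq0 //.
by split=> //; rewrite addf_div.
Qed.

Lemma O_infty_tX n : O_infty (t_infty ^+ n).
Proof.
elim: n => [|n IH]; last by rewrite exprS; apply: O_inftyM => //; apply: O_infty_t.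
by rewrite expr0 -(rmorph1 constf); apply: O_inftyC.
Qed.

(* Gamma(X, O_X(n . infty)) and Gamma(X, O_X( * infty)); see m_infty_principal
   below for t_infty being a local parameter at infinity. *)
Definition GammaO (n : nat) (g : K) : Prop :=
  O_U g /\ O_infty (t_infty ^+ n * g).

Definition GammaO_star (g : K) : Prop := exists n, GammaO n g.

Lemma GammaOC_mul n c g : GammaO n g -> GammaO n (constf c * g).
Proof.
case=> gU gI; split; first by apply: O_UM => //; apply: O_UC.
by rewrite mulrCA; apply: O_inftyM => //; apply: O_inftyC.
Qed.

Lemma GammaOD n g h : GammaO n g -> GammaO n h -> GammaO n (g + h).
Proof.
case=> gU gI [hU hI]; split; first exact: O_UD.
by rewrite mulrDr; apply: O_inftyD.
Qed.

Lemma GammaO0 n : GammaO n 0.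
Proof.
by split; rewrite ?mulr0 -(rmorph0 constf); [apply: O_UC|apply: O_inftyC].
Qed.

Lemma GammaO_le m n g : (m <= n)%N -> GammaO m g -> GammaO n g.
Proof.
move=> le_mn [gU gI]; split => //; rewrite -(subnK le_mn) exprD -mulrA.
by apply: O_inftyM => //; apply: O_infty_tX.
Qed.

(* The module of rational differentials on X over k. *)
Definition Omega : Type := restr constf (kaehler constf).
HB.instance Definition _ := GRing.Lmodule.on Omega.

Definition gdh (g h : K) : Omega := g *: kd constf h.

(* The image of the differentials of a k-subalgebra B of the function field:
   the B-span of { dh | h in B }. *)
Definition forms_of (B : K -> Prop) : kaehler constf -> Prop :=
  spanned B (fun w => exists2 h, B h & w = kd constf h).

(* Gamma(X, Omega_X(n . infty)) and Gamma(X, Omega_X( * infty)) as spaces of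
   rational differentials: where X is smooth, Omega_X is invertible, hence
   embeds in its generic stalk. *)
Definition in_GammaOmega (n : nat) (w : kaehler constf) : Prop :=
  forms_of O_U w /\ forms_of O_infty (t_infty ^+ n *: w).

Definition GammaOmega (n : nat) : {pred Omega} :=
  [pred w : Omega | `[< in_GammaOmega n w >]].

Definition GammaOmega_star : {pred Omega} :=
  [pred w : Omega | `[< exists n, in_GammaOmega n w >]].

Lemma in_GammaOmega0 n : in_GammaOmega n 0.
Proof. by split; rewrite ?scaler0; left. Qed.

Lemma in_GammaOmegaP n (a : k) w w' :
  in_GammaOmega n w -> in_GammaOmega n w' ->
  in_GammaOmega n (constf a *: w + w').
Proof.
move=> [wU wI] [wU' wI']; split.
  apply: spannedD wU'; apply: spannedZ wU => b.
  by apply: O_UM; apply: O_UC.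
rewrite scalerDr scalerA mulrC -scalerA; apply: spannedD wI'.
by apply: spannedZ wI => b; apply: O_inftyM; apply: O_inftyC.
Qed.

Lemma in_GammaOmega_le m n w :
  (m <= n)%N -> in_GammaOmega m w -> in_GammaOmega n w.
Proof.
move=> le_mn [wU wI]; split => //; rewrite -(subnK le_mn) exprD -scalerA.
by apply: spannedZ wI => b; apply: O_inftyM; apply: O_infty_tX.
Qed.

Lemma GammaOmega_closed n : submod_closed (GammaOmega n).
Proof.
split; first exact/asboolP/in_GammaOmega0.
move=> a u v /asboolP ? /asboolP ?; apply/asboolP.
exact: in_GammaOmegaP.
Qed.

Lemma GammaOmega_star_closed : submod_closed GammaOmega_star.
Proof.
split; first by apply/asboolP; exists 0%N; apply: in_GammaOmega0.
move=> a u v /asboolP[m um] /asboolP[n vn]; apply/asboolP.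
exists (maxn m n); apply: in_GammaOmegaP.
  by apply: in_GammaOmega_le um; rewrite leq_maxl.
by apply: in_GammaOmega_le vn; rewrite leq_maxr.
Qed.

HB.instance Definition _ n := GRing.isSubmodClosed.Build k Omega
  (GammaOmega n) (GammaOmega_closed n).
HB.instance Definition _ := GRing.isSubmodClosed.Build k Omega
  GammaOmega_star GammaOmega_star_closed.

Definition nabla (g : K) : Omega := kd constf g + g *: kd constf y.

Definition nabla_im (P : K -> Prop) : {pred Omega} :=
  [pred w : Omega | `[< exists2 g, P g & w = nabla g >]].

Lemma nabla_linear (a : k) g h :
  nabla (constf a * g + h) = a *: nabla g + nabla h.
Proof.
have [dD dM dC] := kd_derivation constf.
rewrite /nabla dD dM dC scaler0 addr0 scalerDl addrACA.
by rewrite -[a *: _]/(constf a *: (_ : kaehler constf)) scalerDr scalerA.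
Qed.

Lemma nabla_im_closed (P : K -> Prop) :
  P 0 -> (forall a g h, P g -> P h -> P (constf a * g + h)) ->
  submod_closed (nabla_im P).
Proof.
move=> P0 PP; split.
  apply/asboolP; exists 0 => //.
  by have := nabla_linear 1 0 0; rewrite mulr0 addr0 scale1r -{1}[nabla 0]add0r => /addIr.
move=> a u v /asboolP[g Pg ->] /asboolP[h Ph ->]; apply/asboolP.
by exists (constf a * g + h); rewrite ?nabla_linear //; apply: PP.
Qed.

Definition nablaO (n : nat) : {pred Omega} := nabla_im (GammaO n).
Definition nablaO_star : {pred Omega} := nabla_im GammaO_star.

Lemma nablaO_closed n : submod_closed (nablaO n).
Proof.
apply: nabla_im_closed; first exact: GammaO0.
by move=> a g h Pg Ph; apply: GammaOD => //; apply: GammaOC_mul.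
Qed.

Lemma nablaO_star_closed : submod_closed nablaO_star.
Proof.
apply: nabla_im_closed; first by exists 0%N; apply: GammaO0.
move=> a g h [m Pg] [n Ph]; exists (maxn m n).
apply: GammaOD; last by apply: GammaO_le Ph; rewrite leq_maxr.
by apply/GammaOC_mul; apply: GammaO_le Pg; rewrite leq_maxl.
Qed.

HB.instance Definition _ n := GRing.isSubmodClosed.Build k Omega
  (nablaO n) (nablaO_closed n).
HB.instance Definition _ := GRing.isSubmodClosed.Build k Omega
  nablaO_star nablaO_star_closed.

(* U being affine, the hypercohomology of O_U -> Omega_U is the cohomology of
   the complex of global sections. *)
Definition H1dR : Type := subquot GammaOmega_star nablaO_star.
HB.instance Definition _ := GRing.Lmodule.on H1dR.

Definition H1dR_class (w : Omega) : H1dR :=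
  class_of GammaOmega_star nablaO_star w.

End Connection.

Arguments t_infty {k} C.
Arguments GammaO {k} C n g.
Arguments GammaO_star {k} C g.
Arguments GammaOmega {k} C n.
Arguments GammaOmega_star {k} C.
Arguments nablaO {k} C n.
Arguments nablaO_star {k} C.

Lemma m_infty_principal (k : fieldType) (lam : k)
    (g : function_field (legendre_curve lam)) :
  m_infty g <-> exists2 h, O_infty h & g = t_infty _ * h.
Proof.
have := legendre_equation lam.
change (ycoord (legendre_curve lam) ^+ 2 =
        xcoord (legendre_curve lam) * (xcoord (legendre_curve lam) - 1) *
        (xcoord (legendre_curve lam) - const (legendre_curve lam) lam) ->
  m_infty g <-> exists2 h, O_infty h & g = t_infty _ * h).
move: (legendre_curve lam) g => C g; rewrite /m_infty /O_infty /t_infty.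
set x := xcoord C; set y := ycoord C => yE.
split=> [[p [q [p0 q0 qn ->]]]|[h [p [q [q0 qn ->]] ->]]]; last first.
  exists ('X * p), q; split=> //; last by rewrite eval2M eval2X mulrA.
  by rewrite hornerM hornerX mul0r hornerC.
set u := x / y; set v := y^-1; set c := const C.
have vE : v = u * (u - v) * (u - c lam * v).
  have [y0|y0] := eqVneq y 0; first by rewrite /u /v y0 invr0 mulr0 !mul0r.
  have -> : u * (u - v) * (u - c lam * v) =
            x * (x - 1) * (x - c lam) / y ^+ 3 by rewrite /u /v; field.
  by rewrite -yE /v; field.
have [r rE] : exists r, p.[0] = r * 'X.
  have /factor_theorem[r rE] : root p.[0] 0 by apply/rootP.
  by exists r; rewrite rE subr0.
have [s sE] : exists s, p = s * 'X + p.[0]%:P.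
  have /factor_theorem[s sE] : root (p - p.[0]%:P) 0.
    by apply/rootP; rewrite hornerD hornerN hornerC subrr.
  by exists s; rewrite -[LHS](subrK p.[0]%:P) sE subr0.
have [w wE] : exists w, eval2 w u v = (u - v) * (u - c lam * v).
  have eN a b : eval2 (a - b) u v = eval2 a u v - eval2 b u v.
    by rewrite /eval2 rmorphB !hornerD !hornerN.
  exists (('X - 'X%:P) * ('X - lam%:P%:P * 'X%:P)).
  by rewrite eval2M !eN eval2M eval2C eval2X eval2Y.
have pE : eval2 p u v = u * eval2 (s + r%:P * w) u v.
  rewrite sE rE polyCM !eval2D !eval2M eval2X eval2Y wE [X in _ + _ * X]vE.
  by ring.
exists (eval2 (s + r%:P * w) u v / eval2 q u v); last by rewrite pE mulrA.
by exists (s + r%:P * w), q; split.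
Qed.

(* Main.v *)
Require Import Defs.
From HB Require Import structures.
From mathcomp Require Import all_boot all_order all_algebra.
From mathcomp Require Import qfpoly fraction separable.
From mathcomp Require Import boolp reals complex ring zify.
Import GRing.Theory.
Local Open Scope ring_scope.

Set Implicit Arguments.
Unset Strict Implicit.
Unset Printing Implicit Defensive.

(** Everything is read off the invariant form w = dx / y, which generates
    the differentials on the affine curve U and at infinity alike.  Writing
    forms as multiples of w, a form has a pole of order at most n at infinity
    exactly when its coefficient does, and nabla becomes the operator
    L(g) = D(g) + g f'(x) / 2 on the ring O(U) = k[x] + k[x] y, where
    f = x (x - 1) (x - lam) and D is the derivation with D(x) = y and
    D(y) = f'(x) / 2.

    The degree of the norm of a(x) + b(x) y is the pole order at infinity; x
    has order 2 and y has order 3.  The derivation D raises the order by at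
    most 1, whereas multiplication by f'(x) / 2 raises it by exactly 4 in
    characteristic other than 2 and 3.  Hence L raises the order of every
    nonzero function by exactly 4.  So if nabla g has a pole of order at most
    5, then g has one of order at most 1 (pole_le_nabla_inv): this is the
    injectivity of the comparison map.  Conversely, dividing a and b by f' / 2
    with remainders of degree at most 1 writes g as h f' / 2 + r, that is, as
    L(h) + r - D(h), where D(h) has a smaller pole than g.  By induction every
    g is L(h) plus a combination of 1, x, y, xy (nabla_reduce).  The
    corresponding forms dx / y, x dx / y, dx, x dx have poles of order at most
    5, which gives both surjectivity and generation.

    Two facts link this to local rings and Kaehler differentials.  A regular
    function g on U with t^n g in the local ring at infinity (t = x / y) has
    pole order at most n: clearing denominators in t^n g = p / q leaves an
    identity in O(U), whose pole orders can be compared (O_infty_pole_le).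
    The module of forms over a subring B of the function field is B w as soon
    as D preserves B and w is a B-combination of differentials of elements of
    B (forms_ofE).  On U this holds because f and f' are coprime, and at
    infinity because D(t) is a unit. *)

(** * The function field of the Legendre curve *)

Section Coordinates.
Variables (k : fieldType) (C : plane_curve k).
Local Notation K := (function_field C).

Definition evx (a : {poly k}) : K := (map_poly (const C) a).[xcoord C].

Definition elt (a b : {poly k}) : K := evx a + evx b * ycoord C.

Lemma evxD a b : evx (a + b) = evx a + evx b.
Proof. by rewrite /evx rmorphD hornerD. Qed.

Lemma evxN a : evx (- a) = - evx a.
Proof. by rewrite /evx rmorphN hornerN. Qed.

Lemma evxM a b : evx (a * b) = evx a * evx b.
Proof. by rewrite /evx rmorphM hornerM. Qed.

Lemma evxC c : evx c%:P = const C c.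
Proof. by rewrite /evx map_polyC hornerC. Qed.

Lemma evxX : evx 'X = xcoord C.
Proof. by rewrite /evx map_polyX hornerX. Qed.

Lemma evx0 : evx 0 = 0.
Proof. by rewrite /evx rmorph0 horner0. Qed.

Lemma evx1 : evx 1 = 1.
Proof. by rewrite /evx rmorph1 hornerC. Qed.

Definition evxE := (evxD, evxN, evxM, evx1, evx0, evxC, evxX).

Lemma elt0r a : elt a 0 = evx a.
Proof. by rewrite /elt evx0 mul0r addr0. Qed.

Lemma elt01 : elt 0 1 = ycoord C.
Proof. by rewrite /elt evx0 evx1 add0r mul1r. Qed.

Lemma eltD a b a' b' : elt a b + elt a' b' = elt (a + a') (b + b').
Proof. by rewrite /elt !evxE; ring. Qed.

End Coordinates.

(** The three properties of the function field and its coordinates that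
    the proof uses; everything about quotients and fraction fields in the
    construction of the field is hidden behind them. *)
Record legendre_model (k : fieldType) (lam : k) (C : plane_curve k) : Prop :=
  LegendreModel {
    model_eq : ycoord C ^+ 2 = evx C (legendre_cubic lam);
    model_free : forall a b, elt C a b = 0 -> a = 0 /\ b = 0;
    model_frac : forall g, exists a b d, d != 0 /\ g = elt C a b / evx C d }.

Lemma linear_poly_eq0 (F : nzRingType) (a b : F) :
  a%:P + b%:P * 'X = 0 -> a = 0 /\ b = 0.
Proof.
move=> /polyP e; have := e 0%N; have := e 1%N.
by rewrite !coefD !coefMX !coefC /= add0r addr0.
Qed.

Lemma linear_polyE (F : nzRingType) (p : {poly F}) :
  (size p <= 2)%N -> p = (p`_0)%:P + (p`_1)%:P * 'X.
Proof.
move=> sp; apply/polyP => i; rewrite coefD coefMX !coefC.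
case: i => [|[|i]] /=; rewrite ?addr0 ?add0r //.
by rewrite nth_default //; apply: leq_trans sp _.
Qed.

Section LegendreModel.
Variables (k : fieldType) (lam : k).
Local Notation C := (legendre_curve lam).
Local Notation P := (legendre_poly lam).
Local Notation tof := (@tofrac {poly k}).

Lemma evx_legendre (a : {poly k}) : evx C a = qpolyC P (tof a) :> funfield lam.
Proof.
elim/poly_ind: a => [|a c IH]; first by rewrite evx0 !rmorph0.
by rewrite !evxE IH !rmorphD !rmorphM.
Qed.

Lemma size_legendre_poly : size (mk_monic P) = 3%N.
Proof.
rewrite mk_monicE; last exact: legendre_poly_irreducible.
rewrite /legendre_poly size_polyDl ?size_polyXn // size_polyN size_polyC.
by case: (_ != _).
Qed.

Lemma qpoly_linear (A B : {fraction {poly k}}) :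
  qpolyC P A + qpolyC P B * qpolyX P = in_qpoly P (A%:P + B%:P * 'X).
Proof.
have small (c : {fraction {poly k}}) : (size c%:P < size (mk_monic P))%N.
  by rewrite size_legendre_poly size_polyC; case: (c != 0).
rewrite rmorphD rmorphM; congr (_ + _ * _);
  by apply/val_inj; rewrite /= Pdiv.CommonRing.rmodp_small.
Qed.

Lemma size_linear (A B : {fraction {poly k}}) :
  (size (A%:P + B%:P * 'X)%R < size (mk_monic P))%N.
Proof.
rewrite size_legendre_poly ltnS; apply: leq_trans (size_polyD _ _) _.
rewrite geq_max; apply/andP; split.
  exact: leq_trans (size_polyC_leq1 _) _.
apply: leq_trans (size_polyMleq _ _) _; rewrite size_polyX.
by have := size_polyC_leq1 B; lia.
Qed.

Lemma funfield_coords (g : funfield lam) :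
  exists A B, g = qpolyC P A + qpolyC P B * qpolyX P.
Proof.
have sg : (size (val g) <= 2)%N.
  rewrite -ltnS; apply: leq_trans (size_mk_monic (g : {poly %/ P})) _.
  by rewrite size_legendre_poly.
move/linear_polyE: sg; move: (_`_0) (_`_1) => A B gE.
exists A, B; rewrite qpoly_linear; apply/val_inj.
by rewrite /= Pdiv.CommonRing.rmodp_small // size_linear.
Qed.

Lemma legendre_curve_model : legendre_model lam C.
Proof.
split.
- have := legendre_equation lam.
  change (ycoord C ^+ 2 = xcoord C * (xcoord C - 1) *
            (xcoord C - const C lam) ->
          ycoord C ^+ 2 = evx C (legendre_cubic lam)).
  by move=> ->; rewrite /legendre_cubic !evxE.
- move=> a b; rewrite /elt !evx_legendre.
  move=> e; have {e} : in_qpoly P ((tof a)%:P + (tof b)%:P * 'X) = 0.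
    by rewrite -qpoly_linear.
  move/(congr1 val); rewrite /= Pdiv.CommonRing.rmodp_small; last first.
    exact: size_linear.
  case/linear_poly_eq0 => /eqP + /eqP.
  by rewrite !tofrac_eq0 => /eqP-> /eqP->.
move=> g; have [A [B gE]] := funfield_coords g.
have [n0 [d0 [d0n e0]]] := fraction_ratio A.
have [n1 [d1 [d1n e1]]] := fraction_ratio B.
exists (n0 * d1), (n1 * d0), (d0 * d1); split; first by rewrite mulf_neq0.
have dn d : d != 0 -> evx C d != 0.
  move=> dn; rewrite evx_legendre; apply: contraNneq dn => e.
  move/(congr1 val): e => /= /eqP; rewrite polyC_eq0 tofrac_eq0. by [].
apply: (canRL (mulfK (dn _ (mulf_neq0 d0n d1n)))).
suff: (qpolyC P A + qpolyC P B * qpolyX P) *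
        (qpolyC P (tof d0) * qpolyC P (tof d1)) =
      qpolyC P (tof n0) * qpolyC P (tof d1) +
        qpolyC P (tof n1) * qpolyC P (tof d0) * qpolyX P.
  by rewrite gE /elt !evxM !evx_legendre.
by rewrite -e0 -e1 !rmorphM /=; ring.
Qed.

End LegendreModel.

(** * Pole orders at infinity of regular functions on the affine curve *)

(* All three sizes are taken over the same structure on F, so that arithmetic
   on sizes sees one unknown per polynomial. *)
Lemma size_mul_field (F : fieldType) (p q : {poly F}) :
  p != 0 -> q != 0 -> size (p * q) = (size p + size q).-1.
Proof. exact: size_mul. Qed.

Section PoleOrder.
Variables (k : fieldType) (lam : k) (C : plane_curve k).
Hypothesis mC : legendre_model lam C.
Local Notation K := (function_field C).
Local Notation f := (legendre_cubic lam).
Local Notation x := (xcoord C).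
Local Notation y := (ycoord C).
Local Notation elt := (elt C).
Local Notation evx := (evx C).

Lemma eltM a b a' b' :
  elt a b * elt a' b' = elt (a * a' + b * b' * f) (a * b' + b * a').
Proof.
have := model_eq mC; move: f => F yF; rewrite /elt !evxE -yF; ring.
Qed.

Lemma elt_inj a b a' b' : elt a b = elt a' b' -> a = a' /\ b = b'.
Proof.
move=> e; have : elt (a - a') (b - b') = 0.
  have -> : elt (a - a') (b - b') = elt a b - elt a' b'.
    by rewrite /elt !evxE; ring.
  by rewrite e subrr.
by case/(model_free mC) => /subr0_eq-> /subr0_eq->.
Qed.

Lemma evx_eq0 a : (evx a == 0) = (a == 0).
Proof.
apply/eqP/eqP => [e|->]; last by rewrite evx0.
by have [] := model_free mC (etrans (elt0r C a) e).
Qed.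

Lemma ycoord_neq0 : y != 0.
Proof.
apply/eqP => y0; have := oner_neq0 {poly k}.
have e := etrans (elt01 C) y0.
by have [_ ->] := model_free mC e; rewrite eqxx.
Qed.

(** The norm of a(x) + b(x) y from the function field down to k(x). *)
Definition norm_poly (a b : {poly k}) := a ^+ 2 - b ^+ 2 * f.

Lemma norm_polyM a b a' b' :
  norm_poly (a * a' + b * b' * f) (a * b' + b * a') =
  norm_poly a b * norm_poly a' b'.
Proof. rewrite /norm_poly; ring. Qed.

(** The two terms of the norm have degrees of opposite parity, so they never
    cancel: this is what makes the degree of the norm a pole order. *)
Lemma size_norm_poly a b n :
  (size (norm_poly a b) <= n.+1)%N =
  ((2 * size a <= n.+2) && (2 * size b <= n.-1))%N.
Proof.
have f0 : f != 0 by rewrite -size_poly_eq0 size_legendre_cubic.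
have sa : size (a ^+ 2) = (2 * size a)%N.-1.
  have [->|a0] := eqVneq a 0; first by rewrite expr0n size_poly0.
  by rewrite expr2 size_mul_field //; lia.
have sb : b != 0 -> size (b ^+ 2 * f) = (2 * size b + 2)%N :> nat.
  move=> b0; rewrite size_mul_field ?expf_neq0 // size_legendre_cubic.
  rewrite expr2 size_mul_field //.
  by move: b0; rewrite -size_poly_gt0; lia.
rewrite /norm_poly; have [->|b0] := eqVneq b 0.
  by rewrite expr0n mul0r subr0 sa size_poly0; lia.
have bp : (0 < size b)%N by rewrite size_poly_gt0.
have sb' := sb b0.
have [sab|sab] := ltnP (size (b ^+ 2 * f)) (size (a ^+ 2)).
  by rewrite size_polyDl ?size_polyN // sa; lia.
rewrite addrC size_polyDl size_polyN ?sb'; first by lia.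
by rewrite sb' in sab *; lia.
Qed.

Lemma norm_poly_eq0 a b : norm_poly a b = 0 -> elt a b = 0.
Proof.
move=> e; have := size_norm_poly a b 0; rewrite e size_poly0 => /esym/andP[_].
rewrite leqn0 muln_eq0 /= size_poly_eq0 => /eqP b0; move: e.
rewrite /norm_poly b0 expr0n mul0r subr0 => /eqP.
by rewrite sqrf_eq0 => /eqP->; rewrite elt0r evx0.
Qed.

(** The norm has as many zeros on the line as the function has on the affine
    curve, so its degree is the pole order at infinity. *)
Definition pole_le (n : nat) (g : K) : Prop :=
  exists a b, g = elt a b /\ (size (norm_poly a b) <= n.+1)%N.

Definition pole_eq (n : nat) (g : K) : Prop :=
  exists a b, g = elt a b /\ size (norm_poly a b) = n.+1.

Lemma pole_leE a b n :
  pole_le n (elt a b) <-> (2 * size a <= n.+2 /\ 2 * size b <= n.-1)%N.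
Proof.
split=> [[a' [b' [/elt_inj[<- <-]]]]|/andP].
  by rewrite size_norm_poly => /andP.
by rewrite -size_norm_poly => s; exists a, b.
Qed.

Lemma pole_leD n g h : pole_le n g -> pole_le n h -> pole_le n (g + h).
Proof.
case=> [a [b [-> s]]] [a' [b' [-> s']]].
rewrite eltD; apply/pole_leE; move: s s'; rewrite !size_norm_poly.
by have := size_polyD a a'; have := size_polyD b b'; lia.
Qed.

Lemma pole_leM m n g h : pole_le m g -> pole_le n h -> pole_le (m + n) (g * h).
Proof.
case=> [a [b [-> s]]] [a' [b' [-> s']]]; rewrite eltM.
exists (a * a' + b * b' * f), (a * b' + b * a'); split=> //.
by rewrite norm_polyM; apply: leq_trans (size_polyMleq _ _) _; lia.
Qed.

Lemma pole_eqM m n g h : pole_eq m g -> pole_eq n h -> pole_eq (m + n) (g * h).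
Proof.
case=> [a [b [-> s]]] [a' [b' [-> s']]]; rewrite eltM.
exists (a * a' + b * b' * f), (a * b' + b * a'); split=> //.
rewrite norm_polyM size_mul_field -?size_poly_gt0 ?s ?s' //; lia.
Qed.

Lemma pole_le_leq m n g : (m <= n)%N -> pole_le m g -> pole_le n g.
Proof. by move=> mn [a [b [-> s]]]; exists a, b; split=> //; lia. Qed.

Lemma pole_eq_le n g : pole_eq n g -> pole_le n g.
Proof. by case=> [a [b [-> s]]]; exists a, b; rewrite s. Qed.

(** A regular function determines its two components, hence its norm and its
    exact order. *)
Lemma pole_eq_minimal m n g : pole_eq m g -> pole_le n g -> (m <= n)%N.
Proof.
by case=> [a [b [-> s]]] [a' [b' [/elt_inj[<- <-]]]]; rewrite s.
Qed.

Lemma pole_leN n g : pole_le n g -> pole_le n (- g).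
Proof.
case=> [a [b [-> s]]]; exists (- a), (- b).
by rewrite /norm_poly !sqrrN /elt !evxE; split=> //; ring.
Qed.

Lemma pole_eqD n g h : pole_eq n.+1 g -> pole_le n h -> pole_eq n.+1 (g + h).
Proof.
move=> pg ph; have : pole_le n.+1 (g + h).
  by apply: pole_leD (pole_le_leq (leqnSn n) ph); apply: pole_eq_le.
case=> [a [b [e s]]]; exists a, b; split=> //; apply/eqP.
rewrite eqn_leq s ltnNge; apply/negP => s'.
have pgh : pole_le n (g + h) by exists a, b.
have : pole_le n g by rewrite -(addrK h g); apply: pole_leD pgh (pole_leN ph).
by move/(pole_eq_minimal pg); rewrite ltnn.
Qed.

Lemma pole_eq_exists a b : elt a b != 0 -> exists n, pole_eq n (elt a b).
Proof.
move=> g0; exists (size (norm_poly a b)).-1, a, b; split=> //.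
rewrite prednK // lt0n size_poly_eq0; apply: contraNneq g0 => e.
by rewrite norm_poly_eq0.
Qed.

Lemma pole_le_const c n : pole_le n (const C c).
Proof.
rewrite -evxC -elt0r; apply/pole_leE; rewrite size_poly0.
by have := size_polyC_leq1 c; lia.
Qed.

Lemma pole_eq_const c : c != 0 -> pole_eq 0 (const C c).
Proof.
move=> c0; exists c%:P, 0; rewrite elt0r evxC; split=> //.
by rewrite /norm_poly expr0n mul0r subr0 expr2 -polyCM size_polyC mulf_neq0.
Qed.

Lemma pole_eq_y : pole_eq 3 y.
Proof.
exists 0, 1; rewrite elt01; split=> //.
by rewrite /norm_poly expr1n mul1r expr0n sub0r size_polyN size_legendre_cubic.
Qed.

Lemma pole_eq_x : pole_eq 2 x.
Proof.
exists 'X, 0; rewrite elt0r evxX; split=> //.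
by rewrite /norm_poly [0 ^+ 2]expr0n mul0r subr0 size_polyXn.
Qed.

Lemma pole_eq_exp m n g : pole_eq m g -> pole_eq (m * n) (g ^+ n).
Proof.
move=> e; elim: n => [|n IH]; last by rewrite exprS mulnS; apply: pole_eqM.
by rewrite muln0 expr0 -(rmorph1 (const C)); apply: pole_eq_const (oner_neq0 _).
Qed.

Lemma O_UE g : O_U g <-> exists a b, g = elt a b.
Proof.
have OUx : O_U x by exists 'X; rewrite eval2X.
have OUy : O_U y by exists 'X%:P; rewrite eval2Y.
have OUev a : O_U (evx a).
  elim/poly_ind: a => [|a c IH].
    by rewrite evx0 -(rmorph0 (const C)); apply: O_UC.
  by rewrite !evxE; apply: O_UD; [apply: O_UM|apply: O_UC].
split=> [[p ->]|[a [b ->]]]; last by apply: O_UD => //; apply: O_UM.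
pose E z := exists a b, z = elt a b.
have ED z w : E z -> E w -> E (z + w).
  by case=> [a [b ->]] [a' [b' ->]]; rewrite eltD; exists (a + a'), (b + b').
have EM z w : E z -> E w -> E (z * w).
  by case=> [a [b ->]] [a' [b' ->]]; rewrite eltM; do 2!eexists.
have EC c : E (const C c) by exists c%:P, 0; rewrite elt0r evxC.
have Ex : E x by exists 'X, 0; rewrite elt0r evxX.
have Ey : E y by exists 0, 1; rewrite elt01.
have E0 : E 0 by rewrite -(rmorph0 (const C)).
rewrite -/(E _); elim/poly_ind: p => [|p r IH].
  by rewrite -polyC0 -[0]polyC0 eval2C.
rewrite eval2D eval2M eval2X; apply: (ED); first exact: (EM).
elim/poly_ind: r => [|r c IHr]; first by rewrite -[0]polyC0 eval2C.
rewrite polyCD polyCM eval2D eval2M eval2Y eval2C.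
by apply: (ED) => //; apply: (EM).
Qed.

Lemma O_U_pole_le g : O_U g -> exists n, pole_le n g.
Proof. by case/O_UE => a [b ->]; exists (size (norm_poly a b)), a, b. Qed.

End PoleOrder.

(** * The local ring at infinity *)

Section LocalRing.
Variables (k : fieldType) (lam : k) (C : plane_curve k).
Hypothesis mC : legendre_model lam C.
Local Notation K := (function_field C).
Local Notation x := (xcoord C).
Local Notation y := (ycoord C).
Local Notation t := (t_infty C).
Local Notation evinf p := (eval2 (C := C) p (x / y) y^-1).

Local Notation pole_le := (pole_le lam).
Local Notation pole_eq := (pole_eq lam).

Let y0 : y != 0 := ycoord_neq0 mC.

(** As y has a pole of order 3, the numerator has a smaller pole than the
    denominator y ^ (d + 1): these quotients have positive order at infinity. *)
Definition vanishing_at_infty (g : K) : Prop :=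
  exists d A, pole_le (3 * d + 2) A /\ g = A / y ^+ d.+1.

Let pole_y d : pole_le (3 * d) (y ^+ d).
Proof. exact/pole_eq_le/(pole_eq_exp mC d (pole_eq_y lam C)). Qed.

Lemma vanishingD g h :
  vanishing_at_infty g -> vanishing_at_infty h -> vanishing_at_infty (g + h).
Proof.
case=> [d [A [pA ->]]] [e [B [pB ->]]].
exists (d + e.+1)%N, (A * y ^+ e.+1 + B * y ^+ d.+1); split.
  apply: (pole_leD mC).
    apply: pole_le_leq (pole_leM mC pA (pole_y e.+1)); lia.
  apply: pole_le_leq (pole_leM mC pB (pole_y d.+1)); lia.
rewrite -addSn exprD; field; rewrite !expf_neq0 //.
Qed.

Lemma vanishingM g h :
  vanishing_at_infty g -> vanishing_at_infty h -> vanishing_at_infty (g * h).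
Proof.
case=> [d [A [pA ->]]] [e [B [pB ->]]].
exists (d + e.+1)%N, (A * B); split.
  by apply: pole_le_leq (pole_leM mC pA pB); lia.
by rewrite -addSn exprD mulf_div.
Qed.

Lemma vanishingZ c g :
  vanishing_at_infty g -> vanishing_at_infty (const C c * g).
Proof.
case=> [d [A [pA ->]]]; exists d, (const C c * A); rewrite mulrA; split=> //.
exact: (pole_leM mC (pole_le_const mC c 0) pA).
Qed.

(** Both coordinates x / y and 1 / y vanish at infinity, and such functions are
    stable under sums, products and scalars. *)
Lemma vanishing_poly p :
  exists2 g, vanishing_at_infty g & evinf p = const C p.[0].[0] + g.
Proof.
pose G z c := exists2 g, vanishing_at_infty g & z = const C c + g.
have GD z c z' c' : G z c -> G z' c' -> G (z + z') (c + c').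
  case=> [g vg ->] [g' vg' ->]; exists (g + g'); first exact: vanishingD.
  by rewrite rmorphD addrACA.
have GM z c z' c' : G z c -> G z' c' -> G (z * z') (c * c').
  case=> [g vg ->] [g' vg' ->].
  exists (const C c * g' + const C c' * g + g * g').
    apply: vanishingD; last exact: vanishingM.
    by apply: vanishingD; apply: vanishingZ.
  by rewrite rmorphM; ring.
have van0 : vanishing_at_infty 0.
  exists 0%N, 0; rewrite mul0r -(rmorph0 (const C)); split=> //.
  exact: pole_le_const.
have GC c : G (const C c) c by exists 0; rewrite ?addr0.
have Gu : G (x / y) 0.
  exists (x / y); last by rewrite rmorph0 add0r.
  by exists 0%N, x; split=> //; apply/pole_eq_le/pole_eq_x.
have Gv : G y^-1 0.
  exists y^-1; last by rewrite rmorph0 add0r.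
  exists 0%N, (const C 1); split; first exact: pole_le_const.
  by rewrite rmorph1 div1r.
rewrite -/(G _ _); elim/poly_ind: p => [|p r IH].
  by rewrite !horner0 -polyC0 -[0]polyC0 eval2C; apply: (GC).
have -> : (p * 'X + r%:P).[0].[0] = p.[0].[0] * 0 + r.[0].
  by rewrite !hornerE.
rewrite eval2D eval2M eval2X; apply: (GD); first exact: GM.
elim/poly_ind: r => [|r c IHr].
  by rewrite horner0 -[0]polyC0 eval2C; apply: (GC).
rewrite polyCD polyCM eval2D eval2M eval2Y eval2C hornerMXaddC.
by apply: (GD) => //; apply: (GM).
Qed.

Lemma leading_term c d A :
  c != 0 -> pole_le (3 * d + 2) A ->
  pole_eq (3 * d.+1) (const C c * y ^+ d.+1 + A).
Proof.
have -> : (3 * d.+1)%N = (3 * d + 2).+1 by lia.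
move=> c0 pA; apply: (pole_eqD mC) pA.
have -> : (3 * d + 2).+1 = (0 + 3 * d.+1)%N by lia.
exact: (pole_eqM mC (pole_eq_const lam C c0)
  (pole_eq_exp mC _ (pole_eq_y lam C))).
Qed.

(** A denominator that does not vanish at the point has nonzero value in the
    function field: its leading term y ^ (d + 1) cannot be cancelled. *)
Lemma evinf_neq0 p : p.[0].[0] != 0 -> evinf p != 0.
Proof.
move=> p0; have [_ [d [A [pA ->]]] ->] := vanishing_poly p.
have lt := leading_term p0 pA; apply/eqP => e.
have e0 : const C p.[0].[0] * y ^+ d.+1 + A = const C 0.
  by rewrite rmorph0 -(mul0r (y ^+ d.+1)) -e mulrDl divfK ?expf_neq0.
rewrite e0 in lt.
by have := pole_eq_minimal mC lt (pole_le_const mC 0 0).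
Qed.

(** The equation of the curve makes x t^2 and y t^3 equal to one and the same
    polynomial in the coordinates at infinity. *)
Lemma O_infty_coordE :
  t ^+ 2 * x = t ^+ 3 * y /\
  t ^+ 3 * y = 1 + const C (1 + lam) * t ^+ 2 - const C lam * t * y^-1.
Proof.
have e := model_eq mC; rewrite /legendre_cubic !evxE in e.
rewrite /t_infty; split; first by field.
have x3 : x ^+ 3 = y ^+ 2 + (1 + const C lam) * x ^+ 2 - const C lam * x.
  by rewrite e; ring.
have -> : (x / y) ^+ 3 * y = x ^+ 3 / y ^+ 2 by field.
by rewrite x3 rmorphD rmorph1; field.
Qed.

Lemma O_infty_v : O_infty (y^-1 : K).
Proof. by rewrite -(eval2Y (x / y) y^-1); apply: O_infty_poly. Qed.

Lemma O_infty_leading : O_infty (t ^+ 3 * y).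
Proof.
have [_ ->] := O_infty_coordE; rewrite -mulrA -mulNr -rmorphN.
have OC c : O_infty (const C c) by exact: O_inftyC.
apply: O_inftyD; last first.
  by apply: O_inftyM => //; apply: O_inftyM O_infty_v; exact: O_infty_t.
apply: O_inftyD; first by rewrite -(rmorph1 (const C)).
by apply: O_inftyM => //; apply: O_infty_tX.
Qed.

Lemma O_infty_evx (a : {poly k}) n :
  (2 * size a <= n.+2)%N -> O_infty (t ^+ n * evx C a).
Proof.
elim/poly_ind: a n => [|a c IH] n.
  by rewrite evx0 mulr0 -(rmorph0 (const C)) => _; apply: O_inftyC.
rewrite size_MXaddC; have [->|a0] /= := eqVneq a 0.
  rewrite mul0r add0r evxC => _; apply: O_inftyM; last exact: O_inftyC.
  exact: O_infty_tX.
move=> s; rewrite evxD evxC mulrDr; apply: O_inftyD; last first.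
  by apply: O_inftyM; [exact: O_infty_tX|exact: O_inftyC].
have a1 : (0 < size a)%N by rewrite size_poly_gt0.
have {}s : (2 * (size a).+1 <= n.+2)%N by [].
case: n s => [|[|n]] s; [lia|lia|].
rewrite evxM evxX.
have -> : t ^+ n.+2 * (evx C a * x) = (t ^+ n * evx C a) * (t ^+ 2 * x).
  by rewrite -addn2 exprD; ring.
apply: O_inftyM; first by apply: IH; lia.
by have [-> _] := O_infty_coordE; apply: O_infty_leading.
Qed.

Lemma pole_le_O_infty n g : pole_le n g -> O_infty (t ^+ n * g).
Proof.
case=> [a [b [-> s]]]; have /(pole_leE mC)[sa sb] : pole_le n (elt C a b).
  by exists a, b.
rewrite mulrDr; apply: O_inftyD; first exact: O_infty_evx.
have [->|b0] := eqVneq b 0.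
  by rewrite evx0 mul0r mulr0 -(rmorph0 (const C)); apply: O_inftyC.
rewrite -size_poly_gt0 in b0.
have -> : n = (3 + (n - 3))%N by lia.
rewrite exprD.
have -> : t ^+ 3 * t ^+ (n - 3) * (evx C b * y) =
          t ^+ (n - 3) * evx C b * (t ^+ 3 * y) by ring.
apply: O_inftyM O_infty_leading; apply: O_infty_evx; lia.
Qed.

(** Clearing denominators in t^n g = p / q gives an equation between regular
    functions on the affine curve, where pole orders are additive. *)
Lemma O_infty_pole_le n g :
  O_U g -> O_infty (t ^+ n * g) -> pole_le n g.
Proof.
move=> /(O_UE mC)[a [b gE]] [p [q [q0 qn tg]]].
have [g0|g0] := eqVneq g 0.
  by rewrite g0 -(rmorph0 (const C)); apply: pole_le_const.
have [N gN] : exists N, pole_eq N g.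
  by rewrite gE; apply: pole_eq_exists; rewrite -?gE.
apply: (pole_le_leq _ (pole_eq_le gN)).
have [_ [d [A [pA ->]]] pE] := vanishing_poly p.
have [_ [e [B [pB ->]]] qE] := vanishing_poly q.
set cp := const C _ in pE; set cq := const C _ in qE.
have pM : pole_eq (3 * e.+1) (cq * y ^+ e.+1 + B) by apply: leading_term.
have key : x ^+ n * g * (cq * y ^+ e.+1 + B) * y ^+ d.+1 =
           (cp * y ^+ d.+1 + A) * (y ^+ n * y ^+ e.+1).
  have tg' : x ^+ n / y ^+ n * g * (cq + B / y ^+ e.+1) = cp + A / y ^+ d.+1.
    by rewrite -pE -qE -expr_div_n -[x / y]/t tg divfK.
  transitivity (x ^+ n / y ^+ n * g * (cq + B / y ^+ e.+1) *
                (y ^+ n * y ^+ e.+1 * y ^+ d.+1)).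
    by field; rewrite !expf_neq0.
  by rewrite tg'; field; rewrite !expf_neq0.
have lhs : pole_eq (2 * n + N + 3 * e.+1 + 3 * d.+1)
    (x ^+ n * g * (cq * y ^+ e.+1 + B) * y ^+ d.+1).
  apply: (pole_eqM mC) (pole_eq_exp mC _ (pole_eq_y lam C)).
  apply: (pole_eqM mC) pM; apply: (pole_eqM mC) gN.
  exact: (pole_eq_exp mC _ (pole_eq_x lam C)).
rewrite key in lhs; have rhs : pole_le (3 * d.+1 + (3 * n + 3 * e.+1))
    ((cp * y ^+ d.+1 + A) * (y ^+ n * y ^+ e.+1)).
  apply: (pole_leM mC); last exact: (pole_leM mC).
  apply: (pole_leD mC) (pole_le_leq _ pA); last lia.
  exact: (pole_leM mC (pole_le_const mC _ 0) (pole_y _)).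
by have := pole_eq_minimal mC lhs rhs; lia.
Qed.

Lemma GammaO_pole_le n g : GammaO C n g <-> pole_le n g.
Proof.
split=> [[gU gI]|pg]; first exact: O_infty_pole_le.
split; last exact: pole_le_O_infty.
by apply/(O_UE mC); case: pg => [a [b [-> _]]]; exists a, b.
Qed.

End LocalRing.

(** * Rational differentials *)

Section Derivation.
Variables (k : fieldType) (C : plane_curve k) (M : lmodType (function_field C)).
Variable D : function_field C -> M.
Hypothesis derD : is_derivation (const C) D.

Lemma derivation_evx a : D (evx C a) = evx C a^`() *: D (xcoord C).
Proof.
have [DD DM DC] := derD; elim/poly_ind: a => [|a c IH].
  by rewrite deriv0 evx0 scale0r -(rmorph0 (const C)) DC.
rewrite derivD derivM derivC derivX mulr1 addr0 !evxE DD DM DC IH addr0.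
by rewrite scalerDl scalerA addrC [xcoord C * _]mulrC.
Qed.

Lemma derivation_elt a b :
  D (elt C a b) = (evx C a^`() + ycoord C * evx C b^`()) *: D (xcoord C)
                + evx C b *: D (ycoord C).
Proof.
have [DD DM DC] := derD.
rewrite DD DM !derivation_evx scalerA scalerDl -!addrA; congr (_ + _).
by rewrite addrC.
Qed.

(** A derivation that vanishes on x and y vanishes on k[x, y], hence on its
    fraction field. *)
Lemma derivation_eq0 lam : legendre_model lam C ->
  D (xcoord C) = 0 -> D (ycoord C) = 0 -> forall g, D g = 0.
Proof.
move=> mC Dx Dy g; have [a [b [d [d0 gE]]]] := model_frac mC g.
have d1 : evx C d != 0 by rewrite (evx_eq0 mC).
have [_ DM _] := derD; have := DM (evx C d) g.
rewrite gE mulrC divfK // derivation_elt Dx Dy derivation_evx Dx.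
rewrite !scaler0 !addr0.
by move/esym/eqP; rewrite scaler_eq0 (negPf d1) => /eqP.
Qed.

End Derivation.

Section Differentials.
Variables (k : fieldType) (lam : k) (C : plane_curve k).
Hypothesis mC : legendre_model lam C.
Hypothesis two_neq0 : 2%:R != 0 :> k.
Local Notation K := (function_field C).
Local Notation f := (legendre_cubic lam).
Local Notation x := (xcoord C).
Local Notation y := (ycoord C).
Local Notation elt := (elt C).
Local Notation evx := (evx C).

Let y0 : y != 0 := ycoord_neq0 mC.

Definition half_deriv : {poly k} := 2%:R^-1 *: f^`().

Lemma half_derivE : f^`() = half_deriv + half_deriv.
Proof.
have e : 2%:R^-1 + 2%:R^-1 = 1 :> k by field.
by rewrite /half_deriv -scalerDl e scale1r.
Qed.

(** The derivation dual to the form dx / y, computed on a(x) + b(x) y: it maps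
    x to y, and y to f'(x) / 2 because y^2 = f(x). *)
Definition del (a b : {poly k}) : K := elt (b^`() * f + b * half_deriv) a^`().

Lemma delD a b a' b' : del (a + a') (b + b') = del a b + del a' b'.
Proof. by rewrite /del eltD !derivD; congr elt; ring. Qed.

Lemma delM a b a' b' :
  del (a * a' + b * b' * f) (a * b' + b * a') =
  elt a b * del a' b' + elt a' b' * del a b.
Proof.
rewrite /del !(eltM mC) eltD; move: half_derivE; move: half_deriv f => h F hE.
by rewrite !(derivD, derivM) hE; congr elt; ring.
Qed.

(** The quotient rule extends the derivation to the function field; it gives
    the same value for all fractions that represent the same function. *)
Lemma rational_derivation :
  exists D : K -> K^o,
    is_derivation (const C) D /\ forall a b, D (elt a b) = del a b.
Proof.
have ev0 d : d != 0 -> evx d != 0 by rewrite (evx_eq0 mC).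
have del_mul a b d : del (a * d) (b * d) = elt a b * del d 0 + evx d * del a b.
  by rewrite -elt0r -delM !(mul0r, mulr0, addr0, add0r).
pose Q a b d : K := (del a b - elt a b / evx d * del d 0) / evx d.
have Q_wd a b d a' b' d' : d != 0 -> d' != 0 ->
    elt a b / evx d = elt a' b' / evx d' -> Q a b d = Q a' b' d'.
  move=> dn dn' e; have en := ev0 _ dn; have en' := ev0 _ dn'.
  have : elt (a * d') (b * d') = elt (a' * d) (b' * d).
    move/eqP: e; rewrite eqr_div // => /eqP; rewrite /elt !evxE => e.
    by rewrite mulrAC -mulrDl e mulrDl mulrAC.
  case/(elt_inj mC) => ea eb.
  have := del_mul a b d'; rewrite ea eb del_mul => e1.
  have elE : elt a' b' = elt a b / evx d * evx d' by rewrite e divfK.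
  rewrite /Q -e; apply/eqP; rewrite eqr_div //; apply/eqP.
  move: e1; rewrite elE; set g := elt a b / _.
  have -> : elt a b = g * evx d by rewrite divfK.
  move=> e1.
  have {}e1 : del a b * evx d' =
      g * evx d' * del d 0 + evx d * del a' b' - g * evx d * del d' 0.
    by rewrite e1; ring.
  by rewrite mulrBl e1; ring.
have [D DE] : exists D : K -> K, forall g a b d, d != 0 ->
    g = elt a b / evx d -> D g = Q a b d.
  suff /choice[D DP] : forall g, exists z, forall a b d, d != 0 ->
    g = elt a b / evx d -> z = Q a b d by exists D.
  move=> g; have [a [b [d [d0 gE]]]] := model_frac mC g; exists (Q a b d).
  by move=> a' b' d' d0'; rewrite gE; apply: Q_wd.
have del_C c : del c%:P 0 = 0.
  by rewrite /del !linear0 derivC mul0r mul0r addr0 elt0r evx0.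
have D_elt a b : D (elt a b) = del a b.
  rewrite (DE _ a b 1) ?oner_neq0 ?evx1 ?divr1 // /Q evx1 !divr1.
  by rewrite -[1]polyC1 del_C mulr0 subr0.
exists D; split=> //; split=> [g h|g h|c].
- have [a [b [d [dn gE]]]] := model_frac mC g.
  have [a' [b' [d' [dn' hE]]]] := model_frac mC h.
  have en := ev0 _ dn; have en' := ev0 _ dn'.
  have sE : g + h = elt (a * d' + a' * d) (b * d' + b' * d) / evx (d * d').
    by rewrite gE hE addf_div // /elt !evxE; congr (_ / _); ring.
  rewrite (DE _ _ _ _ (mulf_neq0 dn dn') sE).
  rewrite (DE _ _ _ _ dn gE) (DE _ _ _ _ dn' hE).
  rewrite /Q -sE delD !del_mul -gE -hE.
  have -> : del (d * d') 0 = evx d * del d' 0 + evx d' * del d 0.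
    by rewrite -[0 in LHS](mul0r d') del_mul elt0r addrC.
  have -> : elt a b = g * evx d by rewrite gE divfK.
  have -> : elt a' b' = h * evx d' by rewrite hE divfK.
  by rewrite evxM; field; rewrite en en'.
- have [a [b [d [dn gE]]]] := model_frac mC g.
  have [a' [b' [d' [dn' hE]]]] := model_frac mC h.
  have en := ev0 _ dn; have en' := ev0 _ dn'.
  have sE : g * h = elt (a * a' + b * b' * f) (a * b' + b * a') / evx (d * d').
    by rewrite gE hE mulf_div evxM (eltM mC).
  rewrite (DE _ _ _ _ (mulf_neq0 dn dn') sE).
  rewrite (DE _ _ _ _ dn gE) (DE _ _ _ _ dn' hE).
  rewrite /Q -sE delM -gE -hE.
  have -> : del (d * d') 0 = evx d * del d' 0 + evx d' * del d 0.
    by rewrite -[0 in LHS](mul0r d') del_mul elt0r addrC.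
  have -> : elt a b = g * evx d by rewrite gE divfK.
  have -> : elt a' b' = h * evx d' by rewrite hE divfK.
  rewrite evxM /GRing.scale /=; field; rewrite en en' //.
- by rewrite -evxC -elt0r D_elt del_C.
Qed.

(** The difference g |-> dg - D(g) dx / y is a derivation that vanishes on x
    and y, so it is zero and dx / y spans the differentials; it is a basis
    since the linear form induced by D takes the value 1 on it. *)
Lemma kaehler_coordinate :
  exists phi : {linear kaehler (const C) -> K^o},
    [/\ forall a b, phi (kd (const C) (elt a b)) = del a b
      & forall w, w = (phi w : K) *: (y^-1 *: kd (const C) x)].
Proof.
have [D [derD D_elt]] := rational_derivation.
have [[phi phiE] _] := kaehler_universal derD.
exists phi; split=> [a b|w]; first by rewrite phiE.
have [DD0 DM0 DC] := derD; have [dD dM dC] := kd_derivation (const C).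
have DD g h : D (g + h) = (D g : K) + D h :> K by exact: DD0.
have DM g h : D (g * h) = g * (D h : K) + h * (D g : K) :> K by exact: DM0.
set omega := y^-1 *: _.
pose E g := kd (const C) g - (D g : K) *: omega.
have derE : is_derivation (const C) E.
  split=> [g h|g h|c]; rewrite /E.
  - by rewrite DD dD scalerDl opprD addrACA.
  - by rewrite DM dM scalerDl !scalerBr !scalerA opprD addrACA.
  - by rewrite DC dC scale0r subr0.
have Dx : D x = y.
  rewrite -evxX -elt0r D_elt /del deriv0 !mul0r addr0 derivX.
  by rewrite elt01.
have Ex : E x = 0 by rewrite /E Dx scalerA divff // scale1r subrr.
have two : 2%:R != 0 :> K by rewrite -(rmorph_nat (const C)) fmorph_eq0.
have Ey : E y = 0.
  have dE2 : (2%:R * y) *: E y = 0.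
    have [_ EM _] := derE; have := EM y y; rewrite -expr2 (model_eq mC).
    rewrite derivation_evx // Ex scaler0 => /esym.
    by rewrite -scalerDl -mulr2n mulr_natl.
  by move/eqP: dE2; rewrite scaler_eq0 mulf_eq0 (negPf two) (negPf y0) => /eqP.
have E0 g : E g = 0 by apply: (derivation_eq0 derE mC).
have idE g : idfun (kd (const C) g) = (phi (kd (const C) g) : K) *: omega.
  by rewrite phiE; apply/eqP; rewrite -subr_eq0; apply/eqP/E0.
pose psi w : kaehler (const C) := (phi w : K) *: omega.
have psi_lin : linear psi.
  move=> a u v; rewrite /psi linearP.
  rewrite (scalerDl omega (a * (phi u : K)) (phi v : K)).
  by congr (_ + _); rewrite -scalerA.
pose psi_mixin :=
  GRing.isLinear.Build K (kaehler (const C)) (kaehler (const C)) _ psi psi_lin.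
pose psiL : {linear kaehler (const C) -> kaehler (const C)} :=
  HB.pack psi psi_mixin.
have [_ uniq] := kaehler_universal (kd_derivation (const C)).
exact: (uniq idfun psiL idE w).
Qed.

End Differentials.

(** * Forms with poles at infinity *)

Section Forms.
Variables (k : fieldType) (lam : k) (C : plane_curve k).
Hypothesis mC : legendre_model lam C.
Hypothesis two_neq0 : 2%:R != 0 :> k.
Local Notation K := (function_field C).
Local Notation f := (legendre_cubic lam).
Local Notation x := (xcoord C).
Local Notation y := (ycoord C).
Local Notation t := (t_infty C).
Local Notation elt := (elt C).
Local Notation evx := (evx C).
Local Notation half_deriv := (half_deriv lam).
Local Notation del := (del lam C).
Local Notation pole_le := (pole_le lam).
Local Notation pole_eq := (pole_eq lam).
Local Notation kd := (kd (const C)).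

Variable phi : {linear kaehler (const C) -> K^o}.
Hypothesis phi_elt : forall a b, phi (kd (elt a b)) = del a b.
Hypothesis phiE : forall w, w = (phi w : K) *: (y^-1 *: kd x).

Let y0 : y != 0 := ycoord_neq0 mC.
Let D (g : K) : K := phi (kd g).

Let DD g h : D (g + h) = D g + D h.
Proof. by have [dD _ _] := kd_derivation (const C); rewrite /D dD linearD. Qed.

Let DM g h : D (g * h) = g * D h + h * D g.
Proof.
have [_ dM _] := kd_derivation (const C).
by rewrite /D dM linearD !linearZ.
Qed.

Let DC c : D (const C c) = 0.
Proof. by have [_ _ dC] := kd_derivation (const C); rewrite /D dC linear0. Qed.

Lemma phi_dx : phi (kd x) = y :> K.
Proof.
rewrite -[x in kd x]evxX -elt0r phi_elt /del deriv0 !mul0r addr0 derivX.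
exact: elt01.
Qed.

Let Dx : D x = y := phi_dx.

Let Dy : D y = evx half_deriv.
Proof.
rewrite -[y in D y]elt01 /D phi_elt /del -[1]polyC1 derivC deriv0.
by rewrite !mul0r mul1r add0r elt0r.
Qed.

Let two : 2%:R != 0 :> K.
Proof. by rewrite -(rmorph_nat (const C)) fmorph_eq0. Qed.

(** As dh = D(h) dx / y, stability of B under D puts all forms inside B dx / y;
    the last hypothesis gives the reverse inclusion. *)
Lemma forms_ofE (B : K -> Prop) (w : kaehler (const C)) :
  B 0 -> (forall g h, B g -> B h -> B (g + h)) ->
  (forall g h, B g -> B h -> B (g * h)) -> (forall g, B g -> B (D g)) ->
  forms_of B (y^-1 *: kd x) -> forms_of B w <-> B (phi w).
Proof.
move=> B0 BD BM Bd Bo; split=> [|Bw]; last first.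
  by rewrite [w]phiE; apply: spannedZ => // a; apply: BM.
elim=> [|a u v Ba [h Bh ->] _ IH]; first by rewrite linear0.
by rewrite linearP; apply: BD => //; apply: BM => //; apply: Bd.
Qed.

Lemma legendre_cubic_separable : lam != 0 -> lam != 1 ->
  exists a b, a * f + b * half_deriv = 1.
Proof.
move=> l0 l1; have : separable_poly f.
  rewrite legendre_cubicE.
  have -> : ('X - 0%:P) * ('X - 1%:P) * ('X - lam%:P) =
            \prod_(c <- [:: 0; 1; lam]) ('X - c%:P).
    by rewrite !big_cons big_nil mulr1 mulrA.
  rewrite separable_prod_XsubC /= !inE negb_or [0 == 1]eq_sym oner_eq0.
  by rewrite [0 == lam]eq_sym [1 == lam]eq_sym l0 l1.
rewrite unlock => /Bezout_eq1_coprimepP[[a b] /= e]; exists a, (b + b).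
by rewrite -e (half_derivE _ two_neq0); ring.
Qed.

(** A Bezout relation a f + b f' / 2 = 1 exhibits dx / y as a y dx + b dy. *)
Lemma forms_O_UE (w : kaehler (const C)) :
  lam != 0 -> lam != 1 -> forms_of (@O_U _ C) w <-> O_U (phi w : K).
Proof.
move=> l0 l1; have OC c : O_U (const C c) by apply: O_UC.
have Oelt a b : O_U (elt a b) by apply/(O_UE mC); exists a, b.
apply: forms_ofE; [|exact: O_UD|exact: O_UM| |].
- by rewrite -(rmorph0 (const C)).
- by move=> g /(O_UE mC)[a [b ->]]; rewrite /D phi_elt; apply: (Oelt).
have [a [b e]] := legendre_cubic_separable l0 l1.
have -> : y^-1 *: kd x = elt 0 a *: kd x + (evx b *: kd y + 0).
  rewrite [kd x in RHS]phiE [kd y]phiE -/(D x) -/(D y) Dx Dy addr0.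
  rewrite !scalerA -!scalerDl.
  have -> : elt 0 a * y = evx (a * f).
    by rewrite evxM -(model_eq mC) /elt evx0; ring.
  by rewrite -(evxM C b) -mulrDl -evxD e evx1 mul1r.
apply: SpannedS; first exact: Oelt.
  by exists x => //; rewrite -evxX -elt0r.
apply: SpannedS; last by left.
  by rewrite -elt0r.
by exists y => //; rewrite -(elt01 C).
Qed.

Lemma evx_half_deriv :
  evx half_deriv =
  (3%:R * x ^+ 2 - 2%:R * (1 + const C lam) * x + const C lam) / 2%:R.
Proof.
apply: (mulIf two); rewrite divfK //.
have -> : evx half_deriv * 2%:R = evx f^`().
  by rewrite (half_derivE _ two_neq0) evxD; ring.
rewrite /legendre_cubic !derivM !derivB derivX !derivC !evxE; ring.
Qed.

(** In the coordinates at infinity D(t) is a polynomial with constant term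
    - 1 / 2, so dt and dx / y generate the same module. *)
Lemma derivation_t_unit : O_infty (D t) /\ O_infty (D t)^-1 /\ D t != 0.
Proof.
pose p : {poly {poly k}} := (- 2%:R^-1)%:P%:P + lam%:P%:P * ('X * 'X%:P)
   + (- (1 + lam) / 2%:R)%:P%:P * ('X * 'X).
have pE : D t = eval2 p (x / y) y^-1.
  rewrite !(eval2D, eval2M, eval2C, eval2X, eval2Y).
  have e : y ^+ 2 = x ^+ 3 - (1 + const C lam) * x ^+ 2 + const C lam * x.
    by rewrite (model_eq mC) /legendre_cubic !evxE; ring.
  have : D x = t * D y + y * D t by rewrite -DM /t_infty divfK.
  rewrite Dx Dy evx_half_deriv => /eqP; rewrite addrC -subr_eq => /eqP yDt.
  apply: (mulfI y0); rewrite -yDt.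
  rewrite !(rmorphM, rmorphN, fmorphV, rmorphD, rmorph1, rmorph_nat).
  apply: (mulfI y0); rewrite /t_infty.
  have -> : y * (y - x / y *
    ((3%:R * x ^+ 2 - 2%:R * (1 + const C lam) * x + const C lam) / 2%:R))
    = y ^+ 2 -
      x * (3%:R * x ^+ 2 - 2%:R * (1 + const C lam) * x + const C lam) / 2%:R.
    by field; rewrite two.
  have -> : x * (3%:R * x ^+ 2 - 2%:R * (1 + const C lam) * x + const C lam)
    = 3%:R * y ^+ 2 + (1 + const C lam) * x ^+ 2 - 2%:R * const C lam * x.
    by rewrite e; ring.
  by field; rewrite two y0.
have p0 : p.[0].[0] != 0.
  have -> : p.[0].[0] = - 2%:R^-1 by rewrite !hornerE /= !(mulr0, mul0r, addr0).
  by rewrite oppr_eq0 invr_eq0.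
have pn := evinf_neq0 mC p0.
split; first by rewrite pE; apply: O_infty_poly.
split; last by rewrite pE.
exists 1%:P%:P, p; rewrite eval2C rmorph1 div1r pE; split=> //.
Qed.

(** It suffices to differentiate the coordinates: D(1 / y) is again a
    polynomial in x / y and 1 / y. *)
Lemma derivation_O_infty g : O_infty g -> O_infty (D g).
Proof.
have OC c : O_infty (const C c) by apply: O_inftyC.
have Dpoly p : O_infty (D (eval2 p (x / y) y^-1)).
  have Dv : O_infty (D y^-1).
    have -> : D y^-1 = const C (- 2%:R^-1) *
       (const C 3%:R * t ^+ 2 + const C (- (2%:R * (1 + lam))) * t * y^-1
        + const C lam * y^-1 * y^-1).
      have : D y^-1 * y + y^-1 * D y = 0.
        by rewrite mulrC -DM divff // -(rmorph1 (const C)) DC.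
      rewrite Dy evx_half_deriv => /(canRL (addrK _)) /(canRL (mulfK y0)) ->.
      rewrite !(rmorphM, rmorphN, fmorphV, rmorphD, rmorph1, rmorph_nat).
      rewrite /t_infty.
      by field; rewrite two y0.
    have Ot := O_infty_t C; have Ov := O_infty_v C.
    apply: O_inftyM => //; apply: O_inftyD; last first.
      by apply: O_inftyM (Ov); apply: O_inftyM.
    apply: O_inftyD; last by apply: O_inftyM (Ov); apply: O_inftyM.
    by apply: O_inftyM => //; apply: O_infty_tX.
  elim/poly_ind: p => [|p r IH].
    by rewrite -polyC0 -[0]polyC0 eval2C DC -(rmorph0 (const C)).
  rewrite eval2D eval2M eval2X DD DM; apply: O_inftyD.
    apply: O_inftyD; apply: O_inftyM => //; first exact: O_infty_poly.
      by have [] := derivation_t_unit.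
    exact: O_infty_t.
  elim/poly_ind: r => [|r c IHr].
    by rewrite -[0]polyC0 eval2C DC -(rmorph0 (const C)).
  rewrite polyCD polyCM eval2D eval2M eval2C eval2Y DD DM DC addr0.
  apply: O_inftyD; apply: O_inftyM => //; first exact: O_infty_poly.
  exact: O_infty_v.
move=> [p [q [q0 qn gE]]].
set Q := eval2 q _ _ in qn gE; set P := eval2 p _ _ in gE.
have Og : O_infty g by exists p, q.
have OQ : O_infty Q^-1 by exists 1%:P%:P, q; rewrite eval2C rmorph1 div1r.
have -> : D g = (D P + const C (-1) * (g * D Q)) * Q^-1.
  have -> : P = Q * g by rewrite gE mulrC divfK.
  by rewrite DM rmorphN rmorph1; field.
apply: O_inftyM => //; apply: O_inftyD; first exact: Dpoly.
by apply: O_inftyM => //; apply: O_inftyM => //; apply: Dpoly.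
Qed.

Lemma forms_O_inftyE (w : kaehler (const C)) :
  forms_of (@O_infty _ C) w <-> O_infty (phi w : K).
Proof.
have OC c : O_infty (const C c) by apply: O_inftyC.
apply: forms_ofE; [|exact: O_inftyD|exact: O_inftyM|exact: derivation_O_infty|].
  by rewrite -(rmorph0 (const C)).
have [_ [Ou Dt]] := derivation_t_unit.
have -> : y^-1 *: kd x = (D t)^-1 *: kd t + 0.
  by rewrite addr0 [kd t]phiE scalerA -/(D t) mulVf // scale1r.
apply: SpannedS => //; last by left.
by exists t => //; apply: O_infty_t.
Qed.

(** Since dx / y generates the forms everywhere, pole orders of forms are
    those of their coefficients. *)
Lemma GammaOmegaE n w : lam != 0 -> lam != 1 ->
  (w \in GammaOmega C n) <-> pole_le n (phi w).
Proof.
move=> l0 l1; rewrite -(GammaO_pole_le mC); split=> [/asboolP[]|[wU wI]].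
  move=> /(forms_O_UE w l0 l1) wU /forms_O_inftyE wI; split=> //.
  by move: wI; rewrite linearZ.
apply/asboolP; split; first exact/forms_O_UE.
by apply/forms_O_inftyE; rewrite linearZ.
Qed.

(** * Pole orders and the connection *)

Hypothesis three_neq0 : 3%:R != 0 :> k.

Lemma size_half_deriv : size half_deriv = 3%N.
Proof.
rewrite /half_deriv size_scale ?invr_eq0 //; apply/eqP; rewrite eqn_leq.
have sf : size f = 4%N by exact: size_legendre_cubic.
have f0 : f != 0 by rewrite -size_poly_gt0 sf.
have /eqP f3 : f \is monic by rewrite legendre_cubicE !rpredM ?monicXsubC.
rewrite -ltnS -sf lt_size_deriv //= ltnNge.
apply: contra three_neq0 => /leq_sizeP/(_ 2%N (leqnn _)).
by rewrite coef_deriv -[3%N]/(4.-1) -sf -lead_coefE f3 => /eqP.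
Qed.

Lemma phi_nabla g : phi (nabla g) = D g + g * evx half_deriv :> K.
Proof.
by rewrite /nabla -/(kd g) (linearD phi (kd g) (g *: kd y)) linearZ -/(D y) Dy.
Qed.

Lemma pole_le_derivation n g : pole_le n g -> pole_le n.+1 (D g).
Proof.
case=> [a [b [-> s]]]; have /(pole_leE mC)[sa sb] : pole_le n (elt a b).
  by exists a, b.
rewrite /D phi_elt /del; apply/(pole_leE mC).
have sd (p : {poly k}) : (size p^`() <= (size p).-1)%N.
  have [->|p0] := eqVneq p 0; first by rewrite deriv0 size_poly0.
  by rewrite -ltnS prednK ?size_poly_gt0 // lt_size_deriv.
have [->|b0] := eqVneq b 0.
  by rewrite deriv0 !mul0r addr0 size_poly0; have := sd a; lia.
have bp : (0 < size b)%N by rewrite size_poly_gt0.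
have s1 : (size (b^`() * f)%R <= size b^`() + 3)%N.
  by apply: leq_trans (size_polyMleq _ _) _; rewrite size_legendre_cubic; lia.
have s2 : (size (b * half_deriv)%R <= size b + 2)%N.
  by apply: leq_trans (size_polyMleq _ _) _; rewrite size_half_deriv; lia.
have s3 : (size (b^`() * f + b * half_deriv)%R <= size b + 2)%N.
  apply: leq_trans (size_polyD _ _) _; rewrite geq_max s2 andbT.
  by apply: leq_trans s1 _; have := sd b; lia.
by have := sd a; lia.
Qed.

Lemma pole_eq_half_deriv : pole_eq 4 (evx half_deriv).
Proof.
exists half_deriv, 0; rewrite elt0r; split=> //.
rewrite /norm_poly expr0n mul0r subr0 expr2 size_mul_field -?size_poly_gt0;
  by rewrite size_half_deriv.
Qed.

Lemma pole_le_nabla n g : pole_le n g -> pole_le (n + 4) (phi (nabla g) : K).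
Proof.
move=> pg; rewrite phi_nabla; apply: (pole_leD mC).
  by apply: pole_le_leq (pole_le_derivation pg); lia.
exact: (pole_leM mC) (pole_eq_le pole_eq_half_deriv).
Qed.

(** The coefficient of g dy has order 4 more than g, the one of dg at most 1
    more, so they cannot cancel. *)
Lemma pole_le_nabla_inv n g :
  pole_le n g -> pole_le 5 (phi (nabla g) : K) -> pole_le 1 g.
Proof.
move=> pg; rewrite phi_nabla => p5.
have [g0|g0] := eqVneq g 0.
  by rewrite g0 -(rmorph0 (const C)); apply: pole_le_const.
have [N gN] : exists N, pole_eq N g.
  by case: pg g0 => [a [b [-> _]]]; apply: pole_eq_exists.
apply: pole_le_leq (pole_eq_le gN).
have : pole_le (maxn 5 N.+1) (g * evx half_deriv).
  rewrite -[g * _](addKr (D g)); apply: (pole_leD mC).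
    apply: pole_leN; apply: pole_le_leq (pole_le_derivation (pole_eq_le gN)).
    exact: leq_maxr.
  by apply: pole_le_leq p5; apply: leq_maxl.
by move/(pole_eq_minimal mC (pole_eqM mC gN pole_eq_half_deriv)); lia.
Qed.

(** Dividing both components of g by f' / 2 gives g = q f' / 2 + r with r in
    the span of 1, x, y, xy.  Up to the coefficient of nabla q, the function g
    is then r - D(q), and D(q) has order at most n - 3 if g has order n. *)
Lemma nabla_reduce g : O_U g -> exists2 h, O_U h & exists c0 c1 c2 c3,
  g = phi (nabla h) + (const C c0 + const C c1 * x + const C c2 * y
        + const C c3 * (x * y)) :> K.
Proof.
move/(O_UE mC)=> [a [b ->]].
have {g} : exists n, (2 * size a <= n.+2)%N /\ (2 * size b <= n.-1)%N.
  by exists (2 * (size a + size b)).+1; lia.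
case=> n; elim/ltn_ind: n a b => n IH a b [sa sb].
have rest (p q : {poly k}) : (size p <= 2)%N -> (size q <= 2)%N ->
    elt p q = const C p`_0 + const C p`_1 * x + const C q`_0 * y
              + const C q`_1 * (x * y).
  move=> sp sq; rewrite [in LHS](linear_polyE sp) [in LHS](linear_polyE sq).
  by rewrite /elt !evxE; ring.
(* At order at most 3 both components are already linear in x. *)
have [n4|n4] := ltnP n 4.
  exists (const C 0); first exact: O_UC.
  exists a`_0, a`_1, b`_0, b`_1; rewrite rest; try lia.
  by rewrite phi_nabla DC rmorph0 mul0r !add0r.
have hn : half_deriv != 0 by rewrite -size_poly_gt0 size_half_deriv.
pose qa := a %/ half_deriv; pose qb := b %/ half_deriv.
pose ra := a %% half_deriv; pose rb := b %% half_deriv.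
have aE : a = qa * half_deriv + ra by exact: divp_eq.
have bE : b = qb * half_deriv + rb by exact: divp_eq.
have sqa : size qa = (size a - 2)%N by rewrite /qa size_divp // size_half_deriv.
have sqb : size qb = (size b - 2)%N by rewrite /qb size_divp // size_half_deriv.
have sra : (size ra <= 2)%N by have := ltn_modpN0 a hn; rewrite size_half_deriv.
have srb : (size rb <= 2)%N by have := ltn_modpN0 b hn; rewrite size_half_deriv.
have abE : elt a b = elt qa qb * evx half_deriv + elt ra rb.
  by rewrite aE bE /elt !evxE; ring.
have : pole_le (n - 4) (elt qa qb) by apply/(pole_leE mC); rewrite sqa sqb; lia.
move/pole_le_derivation; rewrite {1}/D phi_elt /del => /(pole_leE mC).
case/IH; first lia.
move=> h Oh [c0 [c1 [c2 [c3]]]]; rewrite -/(del qa qb) -phi_elt -/(D _) => Dq.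
exists (elt qa qb + const C (-1) * h).
  apply: O_UD; last by apply: O_UM => //; apply: O_UC.
  by apply/(O_UE mC); exists qa, qb.
exists (ra`_0 - c0), (ra`_1 - c1), (rb`_0 - c2), (rb`_1 - c3).
rewrite abE (rest _ _ sra srb); move: Dq; rewrite !phi_nabla DD DM DC => ->.
by rewrite !(rmorphB, rmorphN, rmorph1); ring.
Qed.

End Forms.

(** * Classes in subquotients *)

Section Subquotients.
Variables (R : nzRingType) (V : lmodType R).

Lemma class_ofP (S T : submodClosed V) (u v : V) :
  u \in S -> v \in S -> class_of S T u = class_of S T v <-> u - v \in T.
Proof.
move=> Su Sv.
have e : (insubd (0 : submod S) u - insubd 0 v \in @submod_inter R V S T) =
         (u - v \in T).
  by rewrite inE raddfB /= !insubdK.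
by rewrite -e; split=> [/quotmod_piP|] // h; apply/quotmod_piP.
Qed.

Lemma class_ofD (S T : submodClosed V) (u v : V) :
  u \in S -> v \in S -> class_of S T (u + v) = class_of S T u + class_of S T v.
Proof.
move=> Su Sv; rewrite /class_of -linearD; congr (quotmod_pi _ _).
by apply: val_inj; rewrite raddfD /= !insubdK ?rpredD.
Qed.

Lemma class_ofZ (S T : submodClosed V) a (u : V) :
  u \in S -> class_of S T (a *: u) = a *: class_of S T u.
Proof.
move=> Su; rewrite /class_of -linearZ; congr (quotmod_pi _ _).
by apply: val_inj; rewrite /= !insubdK ?rpredZ.
Qed.

Lemma comb4_in (S : submodClosed V) a0 a1 a2 a3 (u0 u1 u2 u3 : V) :
  u0 \in S -> u1 \in S -> u2 \in S -> u3 \in S ->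
  a0 *: u0 + a1 *: u1 + a2 *: u2 + a3 *: u3 \in S.
Proof. by move=> S0 S1 S2 S3; rewrite !rpredD ?rpredZ. Qed.

Lemma class_of_comb4 (S T : submodClosed V) a0 a1 a2 a3 (u0 u1 u2 u3 : V) :
  u0 \in S -> u1 \in S -> u2 \in S -> u3 \in S ->
  class_of S T (a0 *: u0 + a1 *: u1 + a2 *: u2 + a3 *: u3) =
  a0 *: class_of S T u0 + a1 *: class_of S T u1 + a2 *: class_of S T u2
  + a3 *: class_of S T u3.
Proof.
move=> S0 S1 S2 S3.
by rewrite !class_ofD ?rpredD ?rpredZ // !class_ofZ.
Qed.

Lemma class_of_surj (S T : submodClosed V) (q : subquot S T) :
  exists2 v, v \in S & q = class_of S T v.
Proof.
have [v ->] := quotmod_pi_surj q; exists (val v); first exact: valP.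
by rewrite /class_of valKd.
Qed.

Lemma class_of_generated (S T : submodClosed V) (u0 u1 u2 u3 : V) :
    u0 \in S -> u1 \in S -> u2 \in S -> u3 \in S ->
    (forall v, v \in S -> exists a0 a1 a2 a3,
       v - (a0 *: u0 + a1 *: u1 + a2 *: u2 + a3 *: u3) \in T) ->
  forall c : subquot S T, exists a0 a1 a2 a3,
    c = a0 *: class_of S T u0 + a1 *: class_of S T u1 + a2 *: class_of S T u2
        + a3 *: class_of S T u3.
Proof.
move=> S0 S1 S2 S3 gen c; have [v Sv ->] := class_of_surj c.
have [a0 [a1 [a2 [a3 vT]]]] := gen v Sv; exists a0, a1, a2, a3.
rewrite -class_of_comb4 //; apply/class_ofP => //; exact: comb4_in.
Qed.

(** The hypotheses say that S / T -> S' / T' is well defined, that T' meets S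
    in T, and that S' = S + T'. *)
Lemma subquot_iso (S T S' T' : submodClosed V) :
    {subset S <= S'} -> {subset T <= T'} ->
    (forall v, v \in S -> v \in T' -> v \in T) ->
    (forall v, v \in S' -> exists2 u, u \in S & v - u \in T') ->
  exists F : {linear subquot S T -> subquot S' T'},
    (forall v, v \in S -> F (class_of S T v) = class_of S' T' v) /\ bijective F.
Proof.
move=> SS TT inj surj.
have [r rP] : exists r : subquot S T -> V,
    forall q, r q \in S /\ q = class_of S T (r q).
  suff /choice[r rP] : forall q, exists v, v \in S /\ q = class_of S T v.
    by exists r.
  by move=> q; have [v Sv qE] := class_of_surj q; exists v.
pose F q := class_of S' T' (r q).
have FE v : v \in S -> F (class_of S T v) = class_of S' T' v.
  move=> Sv; have [Sr rE] := rP (class_of S T v).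
  apply/class_ofP; rewrite ?SS //; apply: TT.
  exact/(class_ofP T Sr Sv).
have Flin : linear F.
  move=> a p q; have [[Sp pE] [Sq qE]] := (rP p, rP q).
  rewrite {1}pE {1}qE -class_ofZ // -class_ofD ?rpredZ // FE ?rpredD ?rpredZ //.
  by rewrite class_ofD ?class_ofZ ?rpredZ ?SS.
pose Fmixin := GRing.isLinear.Build R (subquot S T) (subquot S' T') _ F Flin.
exists (HB.pack F Fmixin : {linear subquot S T -> subquot S' T'}).
split=> //.
have Finj : injective F.
  move=> p q; have [[Sp {2}->] [Sq {2}->]] := (rP p, rP q).
  move/(class_ofP T' (SS _ Sp) (SS _ Sq)) => e.
  by apply/class_ofP => //; apply: inj => //; rewrite -scaleN1r rpredD ?rpredZ.
have /choice[G GK] : forall c, exists q, F q = c.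
  move=> c; have [v Sv ->] := class_of_surj c; have [u Su uv] := surj v Sv.
  exists (class_of S T u); rewrite FE //; apply/esym/class_ofP => //; exact: SS.
by exists G => // q; apply: Finj; rewrite GK.
Qed.

End Subquotients.

(** * The cohomology of the connection *)

Section Cohomology.
Variables (k : fieldType) (lam : k) (C : plane_curve k).
Hypothesis mC : legendre_model lam C.
Hypothesis two_neq0 : 2%:R != 0 :> k.
Hypothesis three_neq0 : 3%:R != 0 :> k.
Hypotheses (lam0 : lam != 0) (lam1 : lam != 1).
Local Notation x := (xcoord C).
Local Notation y := (ycoord C).

Lemma legendre_cohomology :
  [/\ {subset nablaO C 1 <= GammaOmega C 5} /\
      {subset nablaO_star C <= GammaOmega_star C},
      {subset GammaOmega C 5 <= GammaOmega_star C} /\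
      (exists phi : {linear subquot (GammaOmega C 5) (nablaO C 1) -> H1dR C},
        (forall w, w \in GammaOmega C 5 ->
           phi (class_of (GammaOmega C 5) (nablaO C 1) w) = H1dR_class w) /\
        bijective phi),
      [/\ gdh y^-1 x \in GammaOmega C 5, gdh (x / y) x \in GammaOmega C 5,
          gdh 1 x \in GammaOmega C 5 & gdh x x \in GammaOmega C 5]
    & forall c : H1dR C, exists a0 a1 a2 a3 : k,
        c = a0 *: H1dR_class (gdh y^-1 x) + a1 *: H1dR_class (gdh (x / y) x)
          + a2 *: H1dR_class (gdh 1 x) + a3 *: H1dR_class (gdh x x)].
Proof.
have y0 : y != 0 := ycoord_neq0 mC.
have [phi [phi_elt phiE]] := kaehler_coordinate mC two_neq0.
have GE n w := GammaOmegaE mC two_neq0 phi_elt phiE n w lam0 lam1.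
have inO n g : GammaO C n g -> nabla g \in GammaOmega C (n + 4).
  move/(GammaO_pole_le mC) => pg; apply/GE.
  exact: (pole_le_nabla mC two_neq0 phi_elt three_neq0).
have le_star n : {subset GammaOmega C n <= GammaOmega_star C}.
  by move=> w /asboolP wn; apply/asboolP; exists n.
(* The coefficient of a form with respect to dx / y. *)
pose co (w : Omega C) : function_field C := phi w.
have phi_gdh g : co (gdh g x) = g * y.
  by rewrite /co /gdh linearZ (phi_dx phi_elt).
have phiD (u v : Omega C) : co (u + v) = co u + co v.
  exact: (linearD phi u v).
have phiZ (c : k) (u : Omega C) : co (c *: u) = const C c * co u.
  exact: (linearZ_LR phi (const C c) u).
have phi4 (c0 c1 c2 c3 : k) (u0 u1 u2 u3 : Omega C) :
    co (c0 *: u0 + c1 *: u1 + c2 *: u2 + c3 *: u3) =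
    const C c0 * co u0 + const C c1 * co u1 + const C c2 * co u2
    + const C c3 * co u3.
  by rewrite !phiD !phiZ.
have phi_inj (u v : Omega C) : co u = co v -> u = v.
  by rewrite /co => e; rewrite [u]phiE [v]phiE e.
have [o0 o1 o2 o3] : [/\ gdh y^-1 x \in GammaOmega C 5,
          gdh (x / y) x \in GammaOmega C 5, gdh 1 x \in GammaOmega C 5
        & gdh x x \in GammaOmega C 5].
  have px := pole_eq_le (pole_eq_x lam C).
  have py := pole_eq_le (pole_eq_y lam C).
  split; apply/GE; rewrite -/(co _) phi_gdh.
  - by rewrite mulVf // -(rmorph1 (const C)); apply: pole_le_const.
  - by rewrite divfK //; apply: pole_le_leq px.
  - by rewrite mul1r; apply: pole_le_leq py.
  - exact: (pole_leM mC px py).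
have decomp (w : Omega C) : w \in GammaOmega_star C ->
    exists2 h, GammaO_star C h & exists c0 c1 c2 c3, w = nabla h +
      (c0 *: gdh y^-1 x + c1 *: gdh (x / y) x + c2 *: gdh 1 x + c3 *: gdh x x).
  move=> /asboolP[n /asboolP wn].
  have {wn}/GE/(GammaO_pole_le mC)[wU _] : w \in GammaOmega C n by [].
  have [h hU [c0 [c1 [c2 [c3 wE]]]]] :=
    nabla_reduce mC two_neq0 phi_elt three_neq0 wU.
  have [m hm] := O_U_pole_le mC hU.
  exists h; first by exists m; apply/(GammaO_pole_le mC).
  exists c0, c1, c2, c3; apply: phi_inj.
  rewrite /co wE -!/(co _) phiD; congr (_ + _).
  by rewrite phi4 !phi_gdh mulVf // divfK // mul1r mulr1.
have sub1 : {subset nablaO C 1 <= GammaOmega C 5}.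
  by move=> w /asboolP[g g1 ->]; apply: (inO 1%N).
have sub_star : {subset nablaO_star C <= GammaOmega_star C}.
  by move=> w /asboolP[g [n gn] ->]; apply: le_star (inO n g gn).
split=> //.
- split; first exact: le_star.
  apply: subquot_iso.
  + exact: le_star.
  + by move=> w /asboolP[g g1 ->]; apply/asboolP; exists g => //; exists 1%N.
  + move=> w /GE w5 /asboolP[g [n /(GammaO_pole_le mC) gn] wE].
    apply/asboolP; exists g => //; apply/(GammaO_pole_le mC).
    apply: (pole_le_nabla_inv mC two_neq0 phi_elt three_neq0 gn).
    by rewrite -wE.
  move=> w /decomp[h hs [c0 [c1 [c2 [c3 wE]]]]].
  eexists; first exact: (comb4_in c0 c1 c2 c3 o0 o1 o2 o3).
  by rewrite wE addrK; apply/asboolP; exists h.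
have gen w : w \in GammaOmega_star C -> exists c0 c1 c2 c3 : k, w -
    (c0 *: gdh y^-1 x + c1 *: gdh (x / y) x + c2 *: gdh 1 x + c3 *: gdh x x)
      \in nablaO_star C.
  case/decomp=> h hs [c0 [c1 [c2 [c3 wE]]]]; exists c0, c1, c2, c3.
  by rewrite wE addrK; apply/asboolP; exists h.
exact: (class_of_generated (le_star _ _ o0) (le_star _ _ o1) (le_star _ _ o2)
  (le_star _ _ o3) gen).
Qed.

End Cohomology.

Theorem proposition1 (R : realType) (k : fieldType)
    (iota : {rmorphism k -> R[i]}) (lam : k) (lam0 : lam != 0)
    (lam1 : lam != 1) :
  let X := legendre_curve lam in
  let x := xcoord X in
  let y := ycoord X in
  [/\ (* both quotients are by subspaces *)
      {subset nablaO X 1 <= GammaOmega X 5} /\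
      {subset nablaO_star X <= GammaOmega_star X},
      (* the inclusion of Gamma(X, Omega_X(5 infty)) in
         Gamma(X, Omega_X( * infty)) induces an isomorphism *)
      {subset GammaOmega X 5 <= GammaOmega_star X} /\
      (exists phi : {linear subquot (GammaOmega X 5) (nablaO X 1) -> H1dR X},
        (forall w, w \in GammaOmega X 5 ->
           phi (class_of (GammaOmega X 5) (nablaO X 1) w) = H1dR_class w) /\
        bijective phi),
      [/\ gdh y^-1 x \in GammaOmega X 5, gdh (x / y) x \in GammaOmega X 5,
          gdh 1 x \in GammaOmega X 5 & gdh x x \in GammaOmega X 5]
    & forall c : H1dR X, exists a0 a1 a2 a3 : k,
        c = a0 *: H1dR_class (gdh y^-1 x) + a1 *: H1dR_class (gdh (x / y) x)
          + a2 *: H1dR_class (gdh 1 x) + a3 *: H1dR_class (gdh x x)].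
Proof.
have char0 n : n.+1%:R != 0 :> k.
  by rewrite -(fmorph_eq0 iota) rmorph_nat Num.Theory.pnatr_eq0.
exact: (legendre_cohomology (legendre_curve_model lam) (char0 1%N) (char0 2%N)
  lam0 lam1).
Qed.
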